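(* Let $G$ be a finite group. If $S$ is an $N$ symmetric sequence in $\mathbf{Set}^G$, then $A(F(S))=\langle A(S)\rangle$.
   Context: $G$ is a finite group with unit $e$. A symmetric sequence of $G$-sets is a sequence $X=(X(n))_{n\ge 0}$ of sets with commuting left $G$- and right $\Sigma_n$-actions, regarded as left $G\times\Sigma_n$-sets via $(g,\sigma)\cdot f=gf\sigma^{-1}$. An operad in $G$-sets is a symmetric operad in the cartesian monoidal category of left $G$-sets (identity $G$-fixed, composition $G$-equivariant). $F$ is the left adjoint of the forgetful functor from operads in $G$-sets to symmetric sequences of $G$-sets. A symmetric sequence $X$ is an $N$ symmetric sequence if each $X(n)$ is $\Sigma_n$-free and $X(0)^G$, $X(2)^G$ are nonempty. For a subgroup $H\subset G$ and a finite $H$-set $T$, choose a total order on $T$, let $\sigma:H\to\Sigma_{|T|}$ be the resulting permutation representation, and put $\Gamma(T)=\{(h,\sigma(h))\mid h\in H\}\subset G\times\Sigma_{|T|}$. $T$ is admissible for a symmetric sequence (or operad) $X$ if $X(|T|)^{\Gamma(T)}\ne\varnothing$ (independent of the order). $A(X)$ is the class of all admissible sets of $X$, graded over the subgroups $H$ of $G$. A class of finite $G$-subgroup actions is a choice, for each subgroup $H\subset G$, of a class $\mathcal{X}(H)$ of finite $H$-sets. A $G$-indexing system is such a class $\mathcal{I}$ satisfying, for all subgroups $K\subset H\subset G$: (1) $\mathcal{I}(H)$ contains all finite trivial $H$-actions; (2) $\mathcal{I}(H)$ is closed under isomorphism; (3) $T\in\mathcal{I}(H)$ implies $\mathrm{res}^H_KT\in\mathcal{I}(K)$;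 (4) $T\in\mathcal{I}(H)$ and $a\in G$ imply $c_aT\in\mathcal{I}(aHa^{-1})$, where $c_aT$ is $T$ with the conjugated action; (5) $\mathcal{I}(H)$ is closed under sub-$H$-sets; (6) $\mathcal{I}(H)$ is closed under binary coproducts; (7) if $T\in\mathcal{I}(K)$ and $H/K\in\mathcal{I}(H)$, then $\mathrm{ind}_K^HT\in\mathcal{I}(H)$. For a class $\mathcal{X}$ of finite $G$-subgroup actions, $\langle\mathcal{X}\rangle$ is the intersection of all $G$-indexing systems containing $\mathcal{X}$. *)

(* Defs.v *)
From HB Require Import structures.
From mathcomp Require Import all_boot all_order all_fingroup.
From Stdlib Require Import FunctionalExtensionality PropExtensionality.
From Stdlib Require Import ClassicalEpsilon.

Set Implicit Arguments.
Unset Strict Implicit.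
Unset Printing Implicit Defensive.

Local Open Scope group_scope.

(* The finite group G is the whole of a finGroupType gT; its subgroups are the
   H : {group gT}. *)

(* Pitfall: MathComp multiplies permutations from left to right,
   [(s * t) i = t (s i)], so a right action of Sigma_n, whose product is the
   composition of functions, satisfies [(x . s) . t = x . (t * s)]. *)
Record symseq (gT : finGroupType) := SymSeq {
  ss_sort :> nat -> Type;
  Gact : forall n, gT -> ss_sort n -> ss_sort n;
  Sact : forall n, ss_sort n -> 'S_n -> ss_sort n;
  Gact1 : forall n (x : ss_sort n), Gact 1 x = x;
  GactM : forall n (g h : gT) (x : ss_sort n),
    Gact (g * h) x = Gact g (Gact h x);
  Sact1 : forall n (x : ss_sort n), Sact x 1 = x;
  SactM : forall n (x : ss_sort n) (s t : 'S_n),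
    Sact (Sact x s) t = Sact x (t * s);
  GSactC : forall n (g : gT) (x : ss_sort n) (s : 'S_n),
    Gact g (Sact x s) = Sact (Gact g x) s
}.

Record symseq_hom (gT : finGroupType) (X Y : symseq gT) := SymSeqHom {
  ss_hom :> forall n, X n -> Y n;
  ss_hom_Gact : forall n (g : gT) (x : X n),
    ss_hom (Gact g x) = Gact g (ss_hom x);
  ss_hom_Sact : forall n (x : X n) (s : 'S_n),
    ss_hom (Sact x s) = Sact (ss_hom x) s
}.

(* [tagnat.Rank i j] is the j-th element of the i-th block of
   ['I_(\sum_i n i)], the blocks being laid out in order. *)

Definition cast (O : nat -> Type) m n (e : m = n) (x : O m) : O n :=
  eq_rect m O x n e.

Section BlockPermutations.
Variables (k : nat) (n : 'I_k -> nat).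

Lemma sum_perm (s : 'S_k) : (\sum_i n (s i) = \sum_i n i)%N.
Proof. by rewrite [RHS](reindex_inj (@perm_inj _ s)). Qed.

Definition block_perm_fun (s : 'S_k) (l : 'I_(\sum_i n i)) :
    'I_(\sum_i n i) :=
  let l' : 'I_(\sum_i n (s i)) := cast_ord (esym (sum_perm s)) l in
  @tagnat.Rank k n (s (tagnat.sig1 l')) (tagnat.sig2 l').

Lemma block_perm_inj (s : 'S_k) : injective (block_perm_fun s).
Proof.
move=> l1 l2 /(congr1 val) /= /eqP; rewrite tagnat.eq_Rank => /andP[/eqP e1].
move=> /eqP e2; apply: (@cast_ord_inj _ _ (esym (sum_perm s))).
apply: tagnat.sig_inj; rewrite !tagnat.sigE12; move/perm_inj: e1 e2.
move: (tagnat.sig1 _) (tagnat.sig2 _) => i1 j1.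
move: (tagnat.sig1 _) (tagnat.sig2 _) => i2 j2 e; move: j1.
by rewrite e => j1 /val_inj->.
Qed.

(* Permutes the blocks: modulo the identification of ['I_(\sum_i n (s i))] with
   ['I_(\sum_i n i)] by values, [(i, j)] goes to [(s i, j)]. *)
Definition block_perm (s : 'S_k) : 'S_(\sum_i n i) :=
  perm (@block_perm_inj s).

Definition sum_perm_fun (t : forall i, 'S_(n i)) (l : 'I_(\sum_i n i)) :
    'I_(\sum_i n i) :=
  @tagnat.Rank k n (tagnat.sig1 l) (t _ (tagnat.sig2 l)).

Lemma sum_perm_inj t : injective (sum_perm_fun t).
Proof.
move=> l1 l2 /(congr1 val) /= /eqP; rewrite tagnat.eq_Rank => /andP[/eqP e1].
move=> /eqP e2; apply: tagnat.sig_inj; rewrite !tagnat.sigE12; move: e1 e2.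
move: (tagnat.sig1 l1) (tagnat.sig2 l1) => i1 j1.
move: (tagnat.sig1 l2) (tagnat.sig2 l2) => i2 j2 e; move: j1.
by rewrite e => j1 /val_inj/perm_inj->.
Qed.

(* Permutes within each block: [(i, j)] goes to [(i, t i j)]. *)
Definition sum_of_perms (t : forall i, 'S_(n i)) : 'S_(\sum_i n i) :=
  perm (@sum_perm_inj t).

Lemma sum_assoc (m : 'I_(\sum_i n i) -> nat) :
  (\sum_l m l = \sum_i \sum_(j < n i) m (tagnat.Rank i j))%N.
Proof.
rewrite (reindex _ (tagnat.rank_bij_on (p_ := n))).
rewrite (sig_big_dep _ _ (fun i (j : 'I_(n i)) => m (tagnat.Rank i j))).
by apply: eq_bigr => p _; rewrite tagnat.rankE.
Qed.

End BlockPermutations.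

Lemma sum_unitl n : (\sum_(i < 1) n = n)%N.
Proof. by rewrite big_ord1. Qed.

Lemma sum_unitr n : (\sum_(i < n) 1 = n)%N.
Proof. by rewrite sum1_card card_ord. Qed.

(* [ocomp x y] is the composite [x (y 0, ..., y (k - 1))].  The convention for
   the right action is that of the endomorphism operad, where
   [(x . s) a = x (a \o s^-1)]; substituting [y \o s] for [y] in the usual
   axiom for permutations of blocks gives [ocomp_block_perm]. *)
Record operad (gT : finGroupType) := Operad {
  op_symseq :> symseq gT;
  ounit : op_symseq 1%N;
  ocomp : forall k (n : 'I_k -> nat),
    op_symseq k -> (forall i, op_symseq (n i)) -> op_symseq (\sum_i n i);
  Gact_ounit : forall g : gT, Gact g ounit = ounit;
  Gact_ocomp : forall k (n : 'I_k -> nat) (g : gT)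
      (x : op_symseq k) (y : forall i, op_symseq (n i)),
    Gact g (ocomp x y) = ocomp (Gact g x) (fun i => Gact g (y i));
  ocomp1l : forall n (x : op_symseq n),
    cast (sum_unitl n) (ocomp ounit (fun _ : 'I_1 => x)) = x;
  ocomp1r : forall n (x : op_symseq n),
    cast (sum_unitr n) (ocomp x (fun _ : 'I_n => ounit)) = x;
  ocompA : forall k (n : 'I_k -> nat) (m : 'I_(\sum_i n i) -> nat)
      (x : op_symseq k) (y : forall i, op_symseq (n i))
      (z : forall l, op_symseq (m l)),
    cast (sum_assoc m) (ocomp (ocomp x y) z) =
    ocomp x (fun i => ocomp (y i) (fun j => z (tagnat.Rank i j)));
  ocomp_block_perm : forall k (n : 'I_k -> nat) (s : 'S_k)
      (x : op_symseq k) (y : forall i, op_symseq (n i)),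
    cast (sum_perm n s) (ocomp (Sact x s) (fun i => y (s i))) =
    Sact (ocomp x y) (block_perm n s);
  ocomp_sum_of_perms : forall k (n : 'I_k -> nat) (t : forall i, 'S_(n i))
      (x : op_symseq k) (y : forall i, op_symseq (n i)),
    ocomp x (fun i => Sact (y i) (t i)) = Sact (ocomp x y) (sum_of_perms t)
}.

Record operad_hom (gT : finGroupType) (O P : operad gT) := OperadHom {
  op_hom :> symseq_hom O P;
  op_hom_unit : op_hom 1%N (ounit O) = ounit P;
  op_hom_comp : forall k (n : 'I_k -> nat) (x : O k) (y : forall i, O (n i)),
    op_hom _ (ocomp x y) = ocomp (op_hom k x) (fun i => op_hom (n i) (y i))
}.

(* [eta : S -> F] is a universal arrow from [S] to the forgetful functor from
   operads to symmetric sequences, i.e. [F] is the value at [S] of the left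
   adjoint of that functor and [eta] is the unit of the adjunction. *)
Definition free_operad (gT : finGroupType) (S : symseq gT) (F : operad gT)
    (eta : symseq_hom S F) : Prop :=
  forall (P : operad gT) (f : symseq_hom S P),
  exists2 h : operad_hom F P,
    forall n (x : S n), h n (eta n x) = f n x &
    forall h' : operad_hom F P, (forall n (x : S n), h' n (eta n x) = f n x) ->
      forall n (x : F n), h' n x = h n x.

(* [free_operad_exists] below: terms modulo the operad identities form a free
   operad. *)
Section FreeOperad.
Variables (gT : finGroupType) (S : symseq gT).

Inductive op_term : nat -> Type :=
| TGen n of S n : op_term n
| TUnit : op_term 1%N
| TGact n of gT & op_term n : op_term n
| TSact n of op_term n & 'S_n : op_term n
| TComp k (n : 'I_k -> nat) of op_term k & (forall i, op_term (n i)) :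
    op_term (\sum_i n i)%N.

Inductive term_eq : forall n, op_term n -> op_term n -> Prop :=
| te_refl n (x : op_term n) : term_eq x x
| te_sym n (x y : op_term n) : term_eq x y -> term_eq y x
| te_trans n (x y z : op_term n) : term_eq x y -> term_eq y z -> term_eq x z
| te_gact n g (x y : op_term n) : term_eq x y -> term_eq (TGact g x) (TGact g y)
| te_sact n s (x y : op_term n) : term_eq x y -> term_eq (TSact x s) (TSact y s)
| te_comp k (n : 'I_k -> nat) (x x' : op_term k)
      (y y' : forall i, op_term (n i)) :
    term_eq x x' -> (forall i, term_eq (y i) (y' i)) ->
    term_eq (TComp x y) (TComp x' y')
| te_gen_gact n g (x : S n) : term_eq (TGen (Gact g x)) (TGact g (TGen x))
| te_gen_sact n s (x : S n) : term_eq (TGen (Sact x s)) (TSact (TGen x) s)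
| te_gact1 n (x : op_term n) : term_eq (TGact 1 x) x
| te_gactM n g h (x : op_term n) :
    term_eq (TGact (g * h) x) (TGact g (TGact h x))
| te_sact1 n (x : op_term n) : term_eq (TSact x 1) x
| te_sactM n (x : op_term n) s t :
    term_eq (TSact (TSact x s) t) (TSact x (t * s))
| te_gsactC n g (x : op_term n) s :
    term_eq (TGact g (TSact x s)) (TSact (TGact g x) s)
| te_gact_unit g : term_eq (TGact g TUnit) TUnit
| te_gact_comp k (n : 'I_k -> nat) g (x : op_term k)
      (y : forall i, op_term (n i)) :
    term_eq (TGact g (TComp x y)) (TComp (TGact g x) (fun i => TGact g (y i)))
| te_comp1l n (x : op_term n) :
    term_eq (cast (sum_unitl n) (TComp TUnit (fun _ : 'I_1 => x))) x
| te_comp1r n (x : op_term n) :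
    term_eq (cast (sum_unitr n) (TComp x (fun _ : 'I_n => TUnit))) x
| te_compA k (n : 'I_k -> nat) (m : 'I_(\sum_i n i)%N -> nat) (x : op_term k)
      (y : forall i, op_term (n i)) (z : forall l, op_term (m l)) :
    term_eq (cast (sum_assoc m) (TComp (TComp x y) z))
      (TComp x (fun i => TComp (y i) (fun j => z (tagnat.Rank i j))))
| te_block_perm k (n : 'I_k -> nat) (s : 'S_k) (x : op_term k)
      (y : forall i, op_term (n i)) :
    term_eq (cast (sum_perm n s) (TComp (TSact x s) (fun i => y (s i))))
      (TSact (TComp x y) (block_perm n s))
| te_sum_of_perms k (n : 'I_k -> nat) (t : forall i, 'S_(n i)) (x : op_term k)
      (y : forall i, op_term (n i)) :
    term_eq (TComp x (fun i => TSact (y i) (t i)))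
      (TSact (TComp x y) (sum_of_perms t)).

Definition free_sort n :=
  {c : op_term n -> Prop | exists x, c = term_eq x}.

Definition op_cls n (x : op_term n) : free_sort n :=
  exist _ (term_eq x) (ex_intro _ x erefl).

Definition op_rep n (c : free_sort n) : op_term n :=
  proj1_sig (constructive_indefinite_description _ (proj2_sig c)).

Lemma cls_eq n (x y : op_term n) : term_eq x y -> op_cls x = op_cls y.
Proof.
move=> xy; have e : term_eq x = term_eq y.
  apply: functional_extensionality => z; apply: propositional_extensionality.
  by split; apply: te_trans => //; apply: te_sym.
rewrite /op_cls; move: (ex_intro _ x _) (ex_intro _ y _); rewrite e => p q.
by rewrite (proof_irrelevance _ p q).
Qed.

Lemma op_repK n (c : free_sort n) : op_cls (op_rep c) = c.
Proof.
rewrite /op_rep; case: (constructive_indefinite_description _ _) => x /= e.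
case: c e => c p /= e; rewrite /op_cls; move: (ex_intro _ x _); rewrite -e => q.
by rewrite (proof_irrelevance _ p q).
Qed.

Lemma op_clsK n (x : op_term n) : term_eq (op_rep (op_cls x)) x.
Proof.
have /(congr1 (@proj1_sig _ _)) /= -> := op_repK (op_cls x); exact: te_refl.
Qed.

Lemma cast_cls m n (e : m = n) (x : op_term m) :
  cast e (op_cls x) = op_cls (cast e x).
Proof. by case: _ / e. Qed.

Definition free_gact n g (c : free_sort n) := op_cls (TGact g (op_rep c)).
Definition free_sact n (c : free_sort n) s := op_cls (TSact (op_rep c) s).
Definition free_comp k (n : 'I_k -> nat) (c : free_sort k)
    (d : forall i, free_sort (n i)) : free_sort (\sum_i n i)%N :=
  op_cls (TComp (op_rep c) (fun i => op_rep (d i))).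

Lemma free_gactE n g (x : op_term n) :
  free_gact g (op_cls x) = op_cls (TGact g x).
Proof. by apply/cls_eq/te_gact/op_clsK. Qed.

Lemma free_sactE n (x : op_term n) s :
  free_sact (op_cls x) s = op_cls (TSact x s).
Proof. by apply/cls_eq/te_sact/op_clsK. Qed.

Lemma free_compE k (n : 'I_k -> nat) (x : op_term k)
    (y : forall i, op_term (n i)) :
  free_comp (op_cls x) (fun i => op_cls (y i)) = op_cls (TComp x y).
Proof. by apply: cls_eq; apply: te_comp => *; apply: op_clsK. Qed.

Lemma free_famE k (n : 'I_k -> nat) (d : forall i, free_sort (n i)) :
  d = fun i => op_cls (op_rep (d i)).
Proof. by apply: functional_extensionality_dep => i; rewrite op_repK. Qed.

Fact free_gact1 n (c : free_sort n) : free_gact 1 c = c.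
Proof. by rewrite -[c]op_repK free_gactE; apply/cls_eq/te_gact1. Qed.

Fact free_gactM n g h (c : free_sort n) :
  free_gact (g * h) c = free_gact g (free_gact h c).
Proof. by rewrite -[c]op_repK !free_gactE; apply/cls_eq/te_gactM. Qed.

Fact free_sact1 n (c : free_sort n) : free_sact c 1 = c.
Proof. by rewrite -[c]op_repK free_sactE; apply/cls_eq/te_sact1. Qed.

Fact free_sactM n (c : free_sort n) s t :
  free_sact (free_sact c s) t = free_sact c (t * s).
Proof. by rewrite -[c]op_repK !free_sactE; apply/cls_eq/te_sactM. Qed.

Fact free_gsactC n g (c : free_sort n) s :
  free_gact g (free_sact c s) = free_sact (free_gact g c) s.
Proof.
by rewrite -[c]op_repK !(free_gactE, free_sactE); apply/cls_eq/te_gsactC.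
Qed.

Definition free_symseq : symseq gT :=
  SymSeq free_gact1 free_gactM free_sact1 free_sactM free_gsactC.

Fact free_gact_unit (g : gT) : free_gact g (op_cls TUnit) = op_cls TUnit.
Proof. by rewrite free_gactE; apply/cls_eq/te_gact_unit. Qed.

Fact free_gact_comp k (n : 'I_k -> nat) g (c : free_sort k)
    (d : forall i, free_sort (n i)) :
  free_gact g (free_comp c d) =
  free_comp (free_gact g c) (fun i => free_gact g (d i)).
Proof.
rewrite /free_comp /free_gact; apply: cls_eq.
apply: te_trans (te_gact _ (op_clsK _)) _.
apply: te_trans (te_gact_comp _ _ _) _.
by apply: te_sym; apply: te_comp => *; apply: op_clsK.
Qed.

Fact free_comp1l n (c : free_sort n) :
  cast (sum_unitl n) (free_comp (op_cls TUnit) (fun _ : 'I_1 => c)) = c.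
Proof.
by rewrite -[c]op_repK free_compE cast_cls; apply/cls_eq/te_comp1l.
Qed.

Fact free_comp1r n (c : free_sort n) :
  cast (sum_unitr n) (free_comp c (fun _ : 'I_n => op_cls TUnit)) = c.
Proof.
by rewrite -[c]op_repK free_compE cast_cls; apply/cls_eq/te_comp1r.
Qed.

Fact free_compA k (n : 'I_k -> nat) (m : 'I_(\sum_i n i)%N -> nat)
    (c : free_sort k) (d : forall i, free_sort (n i))
    (e : forall l, free_sort (m l)) :
  cast (sum_assoc m) (free_comp (free_comp c d) e) =
  free_comp c (fun i => free_comp (d i) (fun j => e (tagnat.Rank i j))).
Proof.
have -> : free_comp (free_comp c d) e =
    op_cls (TComp (TComp (op_rep c) (fun i => op_rep (d i)))
      (fun l => op_rep (e l))).
  by rewrite -free_compE -free_compE op_repK -!free_famE.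
by rewrite cast_cls (cls_eq (te_compA _ _ _)) -free_compE op_repK.
Qed.

Fact free_block_perm k (n : 'I_k -> nat) (s : 'S_k) (c : free_sort k)
    (d : forall i, free_sort (n i)) :
  cast (sum_perm n s) (free_comp (free_sact c s) (fun i => d (s i))) =
  free_sact (free_comp c d) (block_perm n s).
Proof.
rewrite -[c]op_repK (free_famE d) !(free_compE, free_sactE) cast_cls.
exact/cls_eq/te_block_perm.
Qed.

Fact free_sum_of_perms k (n : 'I_k -> nat) (t : forall i, 'S_(n i))
    (c : free_sort k) (d : forall i, free_sort (n i)) :
  free_comp c (fun i => free_sact (d i) (t i)) =
  free_sact (free_comp c d) (sum_of_perms t).
Proof.
rewrite -[c in RHS]op_repK (free_famE d) !(free_compE, free_sactE).
rewrite -(cls_eq (te_sum_of_perms _ _ _)) -free_compE op_repK.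
congr (free_comp _ _).
by apply: functional_extensionality_dep => i; rewrite free_sactE.
Qed.

Definition free_op : operad gT :=
  @Operad gT free_symseq (op_cls TUnit) free_comp free_gact_unit free_gact_comp
    free_comp1l free_comp1r free_compA free_block_perm free_sum_of_perms.

Fact free_unit_gact n (g : gT) (x : S n) :
  op_cls (TGen (Gact g x)) = Gact g (op_cls (TGen x) : free_op n).
Proof. by rewrite /= free_gactE; apply/cls_eq/te_gen_gact. Qed.

Fact free_unit_sact n (x : S n) (s : 'S_n) :
  op_cls (TGen (Sact x s)) = Sact (op_cls (TGen x) : free_op n) s.
Proof. by rewrite /= free_sactE; apply/cls_eq/te_gen_sact. Qed.

Definition free_eta : symseq_hom S free_op :=
  @SymSeqHom gT S free_op (fun n x => op_cls (TGen x))
    free_unit_gact free_unit_sact.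

Section Lift.
Variables (P : operad gT) (f : symseq_hom S P).

Fixpoint op_eval n (x : op_term n) : P n :=
  match x with
  | TGen _ x => f _ x
  | TUnit => ounit P
  | TGact _ g x => Gact g (op_eval x)
  | TSact _ x s => Sact (op_eval x) s
  | TComp _ _ x y => ocomp (op_eval x) (fun i => op_eval (y i))
  end.

Lemma eval_cast m n (e : m = n) (x : op_term m) :
  op_eval (cast e x) = cast e (op_eval x).
Proof. by case: _ / e. Qed.

Lemma eval_eq n (x y : op_term n) : term_eq x y -> op_eval x = op_eval y.
Proof.
elim=> {n x y} //=; intros; rewrite ?eval_cast /=.
- by etransitivity; eassumption.
- by congr Gact.
- by congr Sact.
- congr (ocomp _ _) => //; exact: functional_extensionality_dep.
- exact: ss_hom_Gact.
- exact: ss_hom_Sact.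
- exact: Gact1.
- exact: GactM.
- exact: Sact1.
- exact: SactM.
- exact: GSactC.
- exact: Gact_ounit.
- exact: Gact_ocomp.
- exact: ocomp1l.
- exact: ocomp1r.
- exact: (ocompA (n := n) (m := m)).
- exact: (ocomp_block_perm s _ (fun i => op_eval (y i))).
- exact: ocomp_sum_of_perms.
Qed.

Definition free_lift n (c : free_op n) : P n := op_eval (op_rep c).

Lemma free_liftE n (x : op_term n) : free_lift (op_cls x) = op_eval x.
Proof. exact/eval_eq/op_clsK. Qed.

Fact lift_gact n (g : gT) (c : free_op n) :
  free_lift (Gact g c) = Gact g (free_lift c).
Proof. by rewrite /= /free_gact free_liftE. Qed.

Fact lift_sact n (c : free_op n) (s : 'S_n) :
  free_lift (Sact c s) = Sact (free_lift c) s.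
Proof. by rewrite /= /free_sact free_liftE. Qed.

Definition lift_symseq : symseq_hom free_op P :=
  @SymSeqHom gT free_op P free_lift lift_gact lift_sact.

Fact lift_unit : lift_symseq 1%N (ounit free_op) = ounit P.
Proof. exact: free_liftE. Qed.

Fact lift_comp k (n : 'I_k -> nat) (c : free_op k)
    (d : forall i, free_op (n i)) :
  lift_symseq _ (ocomp c d) =
  ocomp (lift_symseq k c) (fun i => lift_symseq (n i) (d i)).
Proof. exact: free_liftE. Qed.

Definition lift_hom : operad_hom free_op P := OperadHom lift_unit lift_comp.

End Lift.

Lemma free_operad_op : free_operad free_eta.
Proof.
move=> P f; exists (lift_hom f) => [n x|h hP n c]; first exact: free_liftE.
rewrite /= -[c]op_repK free_liftE.
elim: (op_rep c) => {n c} [n x||n g x IH|n x IH s|k n x IHx y IHy] /=.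
- exact: hP.
- exact: (op_hom_unit h).
- by rewrite -IH -ss_hom_Gact /= free_gactE.
- by rewrite -IH -ss_hom_Sact /= free_sactE.
- rewrite -IHx -(functional_extensionality_dep _ _ IHy).
  rewrite -(op_hom_comp h (op_cls x : free_op k) (fun i => op_cls (y i))) /=.
  by rewrite free_compE.
Qed.

End FreeOperad.

Lemma free_operad_exists (gT : finGroupType) (S : symseq gT) :
  exists (F : operad gT) (eta : symseq_hom S F), free_operad eta.
Proof. by exists (free_op S), (free_eta S); apply: free_operad_op. Qed.

(* [x] lies in X(n)^L, for [L] a set of elements of G x Sigma_n acting by
   [(g, s) . x = g x s^-1]. *)
Definition fixed_by (gT : finGroupType) (X : symseq gT) n
    (L : {set gT * 'S_n}) (x : X n) : Prop :=
  forall g s, (g, s) \in L -> Gact g (Sact x s^-1) = x.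

Definition sigma_free (gT : finGroupType) (X : symseq gT) n : Prop :=
  forall (x : X n) (s : 'S_n), Sact x s = x -> s = 1.

Definition has_Gfixed (gT : finGroupType) (X : symseq gT) n : Prop :=
  exists x : X n, forall g : gT, Gact g x = x.

Definition N_symseq (gT : finGroupType) (X : symseq gT) : Prop :=
  [/\ forall n, sigma_free X n, has_Gfixed X 0 & has_Gfixed X 2].

Record hset (gT : finGroupType) (H : {group gT}) := HSet {
  hs_sort :> finType;
  hact : subg_of H -> hs_sort -> hs_sort;
  hact1 : forall x, hact 1 x = x;
  hactM : forall (g h : subg_of H) x, hact (g * h) x = hact g (hact h x)
}.

Definition hset_iso (gT : finGroupType) (H : {group gT}) (T U : hset H) :
    Prop :=
  exists2 f : T -> U, bijective f & forall h x, f (hact h x) = hact h (f x).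

Section Gamma.
Variables (gT : finGroupType) (H : {group gT}) (T : hset H).

Definition Gamma_fun (h : subg_of H) (i : 'I_#|T|) : 'I_#|T| :=
  enum_rank (hact h (enum_val i)).

Lemma Gamma_fun_inj h : injective (Gamma_fun h).
Proof.
apply: (can_inj (g := Gamma_fun h^-1)) => i.
by rewrite /Gamma_fun enum_rankK -hactM mulVg hact1 enum_valK.
Qed.

(* The permutation representation of [T] for the order of [enum T]. *)
Definition Gamma_perm (h : subg_of H) : 'S_#|T| := perm (@Gamma_fun_inj h).

Definition Gamma : {set gT * 'S_#|T|} :=
  [set (sgval h, Gamma_perm h) | h in [set: subg_of H]].

End Gamma.

Definition admissible (gT : finGroupType) (X : symseq gT) (H : {group gT})
    (T : hset H) : Prop :=
  exists x : X #|T|, fixed_by (Gamma T) x.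

Section Restriction.
Variables (gT : finGroupType) (K H : {group gT}) (sKH : K \subset H).

Definition subg_incl (k : subg_of K) : subg_of H :=
  Subg (subsetP sKH _ (subgP k)).

Lemma subg_incl1 : subg_incl 1 = 1.
Proof. exact: val_inj. Qed.

Lemma subg_inclM k l : subg_incl (k * l) = subg_incl k * subg_incl l.
Proof. exact: val_inj. Qed.

Lemma res_act1 (T : hset H) (x : T) : hact (subg_incl 1) x = x.
Proof. by rewrite subg_incl1 hact1. Qed.

Lemma res_actM (T : hset H) k l (x : T) :
  hact (subg_incl (k * l)) x = hact (subg_incl k) (hact (subg_incl l) x).
Proof. by rewrite subg_inclM hactM. Qed.

Definition res (T : hset H) : hset K :=
  @HSet gT K T (fun k => hact (subg_incl k)) (@res_act1 T) (@res_actM T).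

End Restriction.

Section Conjugation.
Variables (gT : finGroupType) (H : {group gT}) (a : gT).

(* [(H :^ a^-1)%G] is a H a^-1, and [g ^ a] is a^-1 g a. *)
Lemma conj_sub_proof (g : subg_of (H :^ a^-1)%G) : sgval g ^ a \in H.
Proof. by rewrite -mem_conjgV subgP. Qed.

Definition conj_sub (g : subg_of (H :^ a^-1)%G) : subg_of H :=
  Subg (conj_sub_proof g).

Lemma conj_act1 (T : hset H) (x : T) : hact (conj_sub 1) x = x.
Proof.
by rewrite (_ : conj_sub 1 = 1) ?hact1 //; apply: val_inj; apply: conj1g.
Qed.

Lemma conj_actM (T : hset H) g h (x : T) :
  hact (conj_sub (g * h)) x = hact (conj_sub g) (hact (conj_sub h) x).
Proof.
by rewrite -hactM; congr hact; apply: val_inj; apply: conjMg.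
Qed.

Definition conj_hset (T : hset H) : hset (H :^ a^-1)%G :=
  @HSet gT (H :^ a^-1)%G T (fun g => hact (conj_sub g))
    (@conj_act1 T) (@conj_actM T).

End Conjugation.

Section SubHSet.
Variables (gT : finGroupType) (H : {group gT}) (T : hset H) (A : {set T}).
Hypothesis actA : forall (h : subg_of H) x, x \in A -> hact h x \in A.

Definition sub_act (h : subg_of H) (x : {x | x \in A}) : {x | x \in A} :=
  exist _ (hact h (val x)) (actA h (valP x)).

Lemma sub_act1 x : sub_act 1 x = x.
Proof. by apply: val_inj; apply: hact1. Qed.

Lemma sub_actM g h x : sub_act (g * h) x = sub_act g (sub_act h x).
Proof. by apply: val_inj; apply: hactM. Qed.

Definition sub_hset : hset H := @HSet gT H _ sub_act sub_act1 sub_actM.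

End SubHSet.

Section Coproduct.
Variables (gT : finGroupType) (H : {group gT}) (T U : hset H).

Definition sum_act (h : subg_of H) (x : T + U) : T + U :=
  match x with inl t => inl (hact h t) | inr u => inr (hact h u) end.

Lemma sum_act1 x : sum_act 1 x = x.
Proof. by case: x => x /=; rewrite hact1. Qed.

Lemma sum_actM g h x : sum_act (g * h) x = sum_act g (sum_act h x).
Proof. by case: x => x /=; rewrite hactM. Qed.

Definition sum_hset : hset H := @HSet gT H _ sum_act sum_act1 sum_actM.

End Coproduct.

(* H/K, as the set of left cosets of K in H. *)
Section Orbit.
Variables (gT : finGroupType) (K H : {group gT}).

Lemma coset_act_proof (h : subg_of H) (C : {C | C \in lcosets K H}) :
  sgval h *: val C \in lcosets K H.
Proof.
case: C => /= C /lcosetsP[x xH ->]; apply/lcosetsP.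
by exists (sgval h * x); [rewrite groupM ?subgP | rewrite lcosetM].
Qed.

Definition coset_act (h : subg_of H) (C : {C | C \in lcosets K H}) :
    {C | C \in lcosets K H} :=
  exist _ (sgval h *: val C) (coset_act_proof h C).

Lemma coset_act1 C : coset_act 1 C = C.
Proof. by apply: val_inj; rewrite /= lcoset1. Qed.

Lemma coset_actM g h C : coset_act (g * h) C = coset_act g (coset_act h C).
Proof. by apply: val_inj; rewrite /= lcosetM. Qed.

Definition coset_hset : hset H := @HSet gT H _ coset_act coset_act1 coset_actM.

End Orbit.

(* H x_K T, as the set of orbits of the action k . (h, t) = (h k^-1, k t) of K
   on H x T. *)
Section Induction.
Variables (gT : finGroupType) (K H : {group gT}) (sKH : K \subset H).
Variable T : hset K.

Definition ind_class (p : subg_of H * T) : {set subg_of H * T} :=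
  [set (p.1 * (subg_incl sKH k)^-1, hact k p.2) | k in [set: subg_of K]].

Definition ind_sort := {B | B \in [set ind_class p | p in [set: _]]}.

Definition ind_shift (h : subg_of H) (B : {set subg_of H * T}) :
    {set subg_of H * T} :=
  [set (h * p.1, p.2) | p in B].

Lemma ind_act_proof (h : subg_of H) (B : ind_sort) :
  ind_shift h (val B) \in [set ind_class p | p in [set: _]].
Proof.
case: B => /= _ /imsetP[p _ ->]; apply/imsetP; exists (h * p.1, p.2) => //.
rewrite /ind_shift /ind_class -imset_comp; apply: eq_imset => k /=.
by rewrite mulgA.
Qed.

Definition ind_act (h : subg_of H) (B : ind_sort) : ind_sort :=
  exist _ (ind_shift h (val B)) (ind_act_proof h B).

Lemma ind_act1 B : ind_act 1 B = B.
Proof.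
apply: val_inj; rewrite /= /ind_shift -[RHS]imset_id.
by apply: eq_imset => -[h t]; rewrite /= mul1g.
Qed.

Lemma ind_actM g h B : ind_act (g * h) B = ind_act g (ind_act h B).
Proof.
apply: val_inj; rewrite /= /ind_shift -imset_comp.
by apply: eq_imset => p; rewrite /= mulgA.
Qed.

Definition ind_hset : hset H := @HSet gT H _ ind_act ind_act1 ind_actM.

End Induction.

Definition subgroup_action_class (gT : finGroupType) :=
  forall H : {group gT}, hset H -> Prop.

Record indexing_system (gT : finGroupType) (I : subgroup_action_class gT) :
    Prop := IndexingSystem {
  is_trivial : forall (H : {group gT}) (T : hset H),
    (forall h (x : T), hact h x = x) -> I H T;
  is_iso : forall (H : {group gT}) (T U : hset H),
    hset_iso T U -> I H T -> I H U;
  is_res : forall (K H : {group gT}) (sKH : K \subset H) (T : hset H),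
    I H T -> I K (res sKH T);
  is_conj : forall (H : {group gT}) (a : gT) (T : hset H),
    I H T -> I (H :^ a^-1)%G (conj_hset a T);
  is_sub : forall (H : {group gT}) (T : hset H) (A : {set T})
      (actA : forall (h : subg_of H) x, x \in A -> hact h x \in A),
    I H T -> I H (sub_hset actA);
  is_sum : forall (H : {group gT}) (T U : hset H),
    I H T -> I H U -> I H (sum_hset T U);
  is_ind : forall (K H : {group gT}) (sKH : K \subset H) (T : hset K),
    I K T -> I H (coset_hset K H) -> I H (ind_hset sKH T)
}.

Definition class_incl (gT : finGroupType) (X Y : subgroup_action_class gT) :
    Prop :=
  forall (H : {group gT}) (T : hset H), X H T -> Y H T.

Definition class_eq (gT : finGroupType) (X Y : subgroup_action_class gT) :
    Prop :=
  forall (H : {group gT}) (T : hset H), X H T <-> Y H T.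

Definition generated_system (gT : finGroupType) (X : subgroup_action_class gT) :
    subgroup_action_class gT :=
  fun H T => forall I : subgroup_action_class gT,
    indexing_system I -> class_incl X I -> I H T.

Definition admissible_sets (gT : finGroupType) (X : symseq gT) :
    subgroup_action_class gT :=
  fun H T => admissible X T.

(* Main.v *)
(* For the inclusion of <A(S)> in A(F(S)): the admissible sets of an operad O
   with G-fixed operations in arities 0 and 2 form an indexing system.  All
   closure properties but the obvious ones follow from one statement: if
   T -> U is a map of H-sets, U is admissible and its fibres are admissible over
   the stabilisers of the points of U, then T is admissible, because the
   operations of the fibres can be chosen equivariantly and substituted into the
   one of U.

   For the converse, no normal form for the elements of the free operad is
   needed.  Given T, embed T into a G-set V, let X be the free S-algebra on V,
   whose elements are trees, and let P be the operad of the maps X^n -> X which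
   use each of their arguments exactly once.  By the universal property F(S)
   maps to P, and evaluating the image of an operation fixed by Gamma(T) at the
   tuple T of elements of V gives an H-fixed tree whose set of leaves is T.  By
   induction on this tree T lies in every indexing system containing A(S): as S
   is Sigma-free, H acts on the set U of branches at the root, this U is
   admissible for S, and T maps to U. *)

Require Import Defs.
From mathcomp Require Import all_boot all_order all_fingroup.
From Stdlib Require Import FunctionalExtensionality PropExtensionality.
From Stdlib Require Import ClassicalEpsilon Eqdep_dec.

Set Implicit Arguments.
Unset Strict Implicit.
Unset Printing Implicit Defensive.

Local Open Scope group_scope.

(** * Maps of H-sets and indexing systems *)

Section HSets.
Variables (gT : finGroupType) (H : {group gT}).

(** Finite choice extracts both maps from the relation, so isomorphisms of sets built from subsets
    and classes need no explicit formulas. *)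
Lemma hset_iso_rel (T U : hset H) (R : T -> U -> Prop) :
  (forall t, exists u, R t u) -> (forall u, exists t, R t u) ->
  (forall t u t' u', R t u -> R t' u' -> t = t' <-> u = u') ->
  (forall h t u, R t u -> R (hact h t) (hact h u)) -> hset_iso T U.
Proof.
move=> /fin_all_exists[f fR] /fin_all_exists[g gR] bij actR.
exists f => [|h t]; last exact/(bij _ _ _ _ (fR _) (actR h _ _ (fR t))).
by exists g => [t|u]; [apply/(bij _ _ _ _ (gR _) (fR t))
  | apply/(bij _ _ _ _ (fR _) (gR u))].
Qed.

Lemma hactK (T : hset H) (h : subg_of H) : cancel (@hact _ _ T h) (hact h^-1).
Proof. by move=> t; rewrite -hactM mulVg hact1. Qed.

Lemma hactKV (T : hset H) (h : subg_of H) : cancel (@hact _ _ T h^-1) (hact h).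
Proof. by move=> t; rewrite -hactM mulgV hact1. Qed.

Lemma hact_inj (T : hset H) (h : subg_of H) : injective (@hact _ _ T h).
Proof. exact: can_inj (hactK h). Qed.

Section Stabiliser.
Variables (U : hset H) (u : U).

Definition stab_set : {set gT} := [set g in H | hact (subg H g) u == u].

Lemma stab_group_set : group_set stab_set.
Proof.
apply/group_setP; split=> [|g h]; first by rewrite inE group1 morph1 hact1 eqxx.
rewrite !inE => /andP[gH /eqP gu] /andP[hH /eqP hu].
by rewrite groupM //= morphM // hactM hu gu.
Qed.

Definition stab : {group gT} := Group stab_group_set.

Lemma stab_sub : stab \subset H.
Proof. by apply/subsetP => g; rewrite inE => /andP[]. Qed.

Lemma mem_stab (h : subg_of H) : (sgval h \in stab) = (hact h u == u).
Proof. by rewrite inE subgP sgvalK. Qed.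

Lemma stab_act (k : subg_of stab) : hact (subg_incl stab_sub k) u = u.
Proof. by apply/eqP; rewrite -mem_stab; apply: (subgP k). Qed.

End Stabiliser.

Section Fibre.
Variables (T U : hset H) (p : T -> U).
Hypothesis p_act : forall h t, p (hact h t) = hact h (p t).
Variable u : U.

Lemma fibre_proof (h : subg_of (stab u)) (t : res (stab_sub u) T) :
  t \in [set t | p t == u] -> hact h t \in [set t | p t == u].
Proof. by rewrite !inE /= p_act => /eqP->; rewrite stab_act. Qed.

Definition fibre : hset (stab u) :=
  @sub_hset _ _ (res (stab_sub u) T) [set t | p t == u] fibre_proof.

End Fibre.

(* [K] is the stabiliser of [u], and [j] identifies [B] with the fibre over [u]. *)
Definition fibrewise (X : subgroup_action_class gT) (T U : hset H)
    (p : T -> U) : Prop :=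
  forall u, exists (K : {group gT}) (sKH : K \subset H) (B : hset K)
      (j : B -> T),
    [/\ forall h : subg_of H, (sgval h \in K) = (hact h u == u),
        injective j,
        forall k b, j (hact k b) = hact (subg_incl sKH k) (j b),
        forall t, p t = u <-> exists b, j b = t
      & X K B].

Lemma fibrewise_fibre (X : subgroup_action_class gT) (T U : hset H)
    (p : T -> U) (p_act : forall h t, p (hact h t) = hact h (p t)) :
  (forall u, X (stab u) (fibre p_act u)) -> fibrewise X p.
Proof.
move=> XF u; exists (stab u), (stab_sub u), (fibre p_act u), val.
split=> // [h||t].
- exact: mem_stab.
- exact: val_inj.
- split=> [pt|[[t' /= pt'] <-]]; last by apply/eqP; rewrite inE in pt'.
  have pt' : t \in [set t | p t == u] by rewrite inE pt.
  by exists (exist _ t pt').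
Qed.

Lemma ind_classP (K : {group gT}) (sKH : K \subset H) (B : hset K)
    (x y : subg_of H * B) :
  ind_class sKH x = ind_class sKH y <->
  exists k, y = (x.1 * (subg_incl sKH k)^-1, hact k x.2).
Proof.
split=> [e|[k ->]].
  have : y \in ind_class sKH x.
    rewrite e; apply/imsetP; exists 1; first exact: in_setT.
    by rewrite subg_incl1 invg1 mulg1 hact1; case: y {e}.
  by case/imsetP => k _ ->; exists k.
apply/setP => z; apply/imsetP/imsetP => -[l _ ->].
  exists (l * k^-1); rewrite ?in_setT //= -hactM mulgKV subg_inclM.
  have -> : subg_incl sKH k^-1 = (subg_incl sKH k)^-1 by apply: val_inj.
  by rewrite invMg invgK mulgA mulgKV.
exists (l * k); rewrite ?in_setT //= -hactM subg_inclM; congr (_, _).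
by rewrite invMg mulgA.
Qed.

Lemma ind_shift_class (K : {group gT}) (sKH : K \subset H) (B : hset K) h
    (x : subg_of H * B) :
  ind_shift h (ind_class sKH x) = ind_class sKH (h * x.1, x.2).
Proof.
rewrite /ind_shift /ind_class -imset_comp; apply: eq_imset => k /=.
by rewrite mulgA.
Qed.

(* [ind_K^H B] is recognized as the inverse image of an orbit: the classes
   [h, b] correspond to the elements [h (j b)]. *)
Lemma is_fibrewise (I : subgroup_action_class gT) (T U : hset H)
    (p : T -> U) : indexing_system I ->
  (forall h t, p (hact h t) = hact h (p t)) -> I H U -> fibrewise I p -> I H T.
Proof.
move=> isI p_act IU fibI.
have preim_act (A : {set U}) : (forall h x, x \in A -> hact h x \in A) ->
    forall h t, t \in [set t | p t \in A] -> hact h t \in [set t | p t \in A].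
  by move=> actA h t; rewrite !inE p_act; apply: actA.
(* Induction on the size of an invariant subset [A] of [U], removing one orbit at a time; [A = setT]
   gives back [T] up to isomorphism. *)
suff main n (A : {set U}) (actA : forall h x, x \in A -> hact h x \in A) :
    (#|A| <= n)%N -> I H (sub_hset (preim_act A actA)).
  have actT h (x : U) : x \in setT -> hact h x \in setT by rewrite !inE.
  apply: is_iso (main _ setT actT (leqnn _)) => //.
  apply: (@hset_iso_rel _ _ (fun (x : sub_hset (preim_act _ actT)) (t : T) =>
    val x = t)) => //.
  - by move=> x; exists (val x).
  - move=> t; have tT : t \in [set t | p t \in setT] by rewrite !inE.
    by exists (exist _ t tT).
  - by move=> x t x' t' <- <-; split=> [->|/val_inj].
  - by move=> h x t /= ->.
elim: n A actA => [|n IHn] A actA.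
  rewrite leqn0 cards_eq0 => /eqP A0; apply: is_trivial => // h [t tA].
  by exfalso; move: tA; rewrite inE A0 inE.
case: (set_0Vmem A) => [A0 _|[u uA] leA].
  by apply: IHn; rewrite A0 cards0.
have [K [sKH [B [j [memK j_inj j_act jP IB]]]]] := fibI u.
pose O := [set hact h u | h in [set: subg_of H]].
have uO g : hact g u \in O by apply/imsetP; exists g; rewrite ?in_setT.
have actO h x : x \in O -> hact h x \in O.
  by case/imsetP => g _ ->; rewrite -hactM uO.
have actC h x : x \in A :\: O -> hact h x \in A :\: O.
  rewrite !inE => /andP[xO xA]; rewrite actA // andbT.
  by apply: contra xO => /(actO h^-1); rewrite hactK.
have IC : I H (sub_hset (preim_act _ actC)).
  apply: IHn; rewrite -ltnS; apply: leq_trans leA.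
  apply/proper_card/properP; split; first exact: subsetDl.
  exists u => //; rewrite inE negb_and negbK; apply/orP; left.
  by apply/imsetP; exists 1; rewrite ?hact1.
(* By orbit-stabiliser H/K is isomorphic to the orbit [O], a sub-H-set of [U]. *)
have IHK : I H (coset_hset K H).
  apply: (@is_iso _ _ isI _ (sub_hset actO)); last exact: is_sub.
  apply: (@hset_iso_rel _ _ (fun (x : sub_hset actO) (C : coset_hset K H) =>
    exists2 h : subg_of H, val x = hact h u & val C = sgval h *: K)).
  - case=> x /= /imsetP[h _ ex].
    have CP : sgval h *: K \in lcosets K H.
      by apply/lcosetsP; exists (sgval h); rewrite ?subgP.
    by exists (exist (fun C => C \in lcosets K H) _ CP), h.
  - case=> C /= /lcosetsP[g gH ->].
    have xP := uO (subg H g).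
    by exists (exist (fun x => x \in O) _ xP), (subg H g); rewrite ?subgK.
  - move=> x C x' C' [h ex eC] [h' ex' eC'].
    have e : (hact h u == hact h' u) = (sgval h *: K == sgval h' *: K).
      rewrite eq_sym -(inj_eq (@hact_inj _ h^-1)) hactK -hactM -memK.
      apply/idP/eqP => [/= m|e]; last by rewrite -mem_lcoset e lcoset_refl.
      by apply/esym/lcoset_eqP; rewrite mem_lcoset.
    split=> [exx|eCC]; apply: val_inj; apply/eqP.
      by rewrite eC eC' -e -ex -ex' exx.
    by rewrite ex ex' e -eC -eC' eCC.
  - move=> g x C [h ex eC]; exists (g * h); first by rewrite /= ex hactM.
    by rewrite /= eC lcosetM.
(* The preimage of [A] is the coproduct of the preimage of [A :\: O] and the set induced from the
   fibre over [u]. *)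
have sumP := is_sum isI IC (is_ind isI sKH IB IHK).
apply: is_iso isI _ _ _ _ sumP; apply: (@hset_iso_rel _ _ (fun
    (x : sum_hset (sub_hset (preim_act _ actC)) (ind_hset sKH B))
    (t : sub_hset (preim_act _ actA)) =>
  match x with
  | inl c => val c = val t
  | inr y => exists h b, val y = ind_class sKH (h, b) /\ val t = hact h (j b)
  end)).
- case=> [[c /= cP]|[y /= /imsetP[[h b] _ ey]]].
    have tA : c \in [set t | p t \in A] by move: cP; rewrite !inE => /andP[].
    by exists (exist _ c tA).
  have tA : hact h (j b) \in [set t | p t \in A].
    by rewrite inE p_act actA // (iffRL (jP _)) //; exists b.
  by exists (exist (fun t => t \in [set t | p t \in A]) _ tA), h, b.
- case=> t /= tA; case: (boolP (p t \in O)) => [|tO].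
    case/imsetP => h _ eh; have /jP[b eb] : p (hact h^-1 t) = u.
      by rewrite p_act eh hactK.
    have yP : ind_class sKH (h, b) \in [set ind_class sKH p | p in [set: _]].
      exact: imset_f.
    exists (inr (exist (fun y => y \in [set ind_class sKH p | p in [set: _]])
      _ yP)).
    by exists h, b; rewrite eb hactKV.
  have tC : t \in [set t | p t \in A :\: O].
    by move: tA; rewrite !inE tO.
  by exists (inl (exist _ t tC)).
- have jO h b : p (hact h (j b)) \in O.
    by rewrite p_act (iffRL (jP (j b))) ?uO //; exists b.
  move=> [c|y] t [c'|y'] t'.
  + move=> e e'; split=> [[ec]|et]; first by apply: val_inj; rewrite -e ec.
    by congr inl; apply: val_inj; rewrite e e' et.
  + move=> e [h [b [_ e']]]; split=> // et; exfalso; case: c e => c /= cP e.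
    by move: cP; rewrite e et e' !inE jO.
  + move=> [h [b [_ e]]] e'; split=> // et; exfalso; case: c' e' => c /= cP e'.
    by move: cP; rewrite e' -et e !inE jO.
  + move=> [h [b [ey et]]] [h' [b' [ey' et']]].
    split=> [[eyy]|ett].
      apply: val_inj; rewrite et et'.
      have /ind_classP[k [-> ->]] :
          ind_class sKH (h, b) = ind_class sKH (h', b').
        by rewrite -ey -ey' eyy.
      by rewrite j_act hactM hactK.
    congr inr; apply: val_inj; rewrite ey ey'; apply/ind_classP => /=.
    have e : hact h (j b) = hact h' (j b') by rewrite -et -et' ett.
    have pj b1 : p (j b1) = u by apply/jP; exists b1.
    (* Both [j b] and [j b'] lie over [u], so the element relating them stabilises [u]. *)
    have kK : sgval (h'^-1 * h) \in K.
      by rewrite memK hactM -{1}(pj b) -p_act e p_act pj hactK.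
    have ek : subg_incl sKH (subg K (sgval (h'^-1 * h))) = h'^-1 * h.
      by apply: val_inj; rewrite /= subgK.
    exists (subg K (sgval (h'^-1 * h))); congr (_, _).
      by rewrite ek invMg invgK mulKVg.
    by apply: j_inj; rewrite j_act ek hactM e hactK.
- move=> g [c|y] t /= => [->//|[h [b [ey et]]]]; exists (g * h), b.
  split; last by rewrite et hactM.
  by rewrite ey ind_shift_class.
Qed.

End HSets.

(** * Admissible sets of an operad *)

Lemma sum_of_permsE k (n : 'I_k -> nat) (t : forall i, 'S_(n i)) i j :
  sum_of_perms t (tagnat.Rank i j) = tagnat.Rank i (t i j).
Proof.
by rewrite permE /sum_perm_fun /tagnat.sig1 /tagnat.sig2
  [tagnat.sig _]tagnat.rankK.
Qed.

Lemma block_permE k (n : 'I_k -> nat) (s : 'S_k) i (j : 'I_(n (s i))) :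
  block_perm n s (cast_ord (sum_perm n s) (tagnat.Rank i j)) =
  tagnat.Rank (s i) j.
Proof.
by rewrite permE /block_perm_fun cast_ordK /tagnat.sig1 /tagnat.sig2
  [tagnat.sig _]tagnat.rankK.
Qed.

(** * Relabelling the inputs of operations *)

Section Renaming.
Variables (gT : finGroupType) (X : symseq gT).

(* Relabelling the inputs of [x] along the bijection [f] gives [y]; in an
   endomorphism operad, [y a = x (a \o f)]. *)
Definition ren m n (f : 'I_m -> 'I_n) (x : X m) (y : X n) : Prop :=
  exists (e : m = n) (s : 'S_n),
    (forall i, f i = s (cast_ord e i)) /\ cast e x = Sact y s.

Lemma ren_perm n (f : 'I_n -> 'I_n) (s : 'S_n) (x y : X n) :
  f =1 s -> x = Sact y s -> ren f x y.
Proof.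
by move=> fs e; exists (erefl n), s; split=> // i; rewrite fs cast_ord_id.
Qed.

Lemma ren_id n (f : 'I_n -> 'I_n) (x : X n) : f =1 id -> ren f x x.
Proof.
by move=> fid; apply: (@ren_perm _ _ 1) => [i|]; rewrite ?perm1 ?Sact1.
Qed.

Lemma renP n (f : 'I_n -> 'I_n) (x y : X n) :
  ren f x y -> exists2 s : 'S_n, f =1 s & x = Sact y s.
Proof.
case=> e [s [fs]]; rewrite (eq_axiomK e) /= => ->.
by exists s => // i; rewrite fs cast_ord_id.
Qed.

Lemma ren_comp l m n (f : 'I_l -> 'I_m) (g : 'I_m -> 'I_n) x y z :
  ren f x y -> ren g y z -> ren (g \o f) x z.
Proof.
move=> [e [s [fs xy]]] [e' [t [gt yz]]]; subst l m; move: xy yz => /= -> ->.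
exists (erefl n), (s * t); rewrite SactM; split=> // i /=.
by rewrite gt fs !cast_ord_id permM.
Qed.

Lemma ren_Gact m n (f : 'I_m -> 'I_n) g x y :
  ren f x y -> ren f (Gact g x) (Gact g y).
Proof.
move=> [e [s [fs xy]]]; exists e, s; split=> //; subst m.
by move: xy => /= ->; rewrite GSactC.
Qed.

Variables (H : {group gT}) (T : hset H).

Definition fixed_labelled n (e : 'I_n -> T) (x : X n) : Prop :=
  forall (h : subg_of H) (f : 'I_n -> 'I_n),
    (forall i, e (f i) = hact h (e i)) -> ren f (Gact (sgval h) x) x.

(** Admissibility does not depend on the order chosen on [T]; any bijective labelling of the inputs
    may replace that of [enum T]. *)
Lemma admissibleP : admissible X T <->
  exists (n : nat) (e : 'I_n -> T) (x : X n), bijective e /\ fixed_labelled e x.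
Proof.
split=> [[x xfix]|[n [e [x [e_bij xfix]]]]].
  exists #|T|, enum_val, x; split; first exact: enum_val_bij.
  move=> h f fE; apply: (@ren_perm _ _ (Gamma_perm T h)) => [i|].
    by rewrite permE /Gamma_fun -fE enum_valK.
  have /xfix/(congr1 (fun y => Sact y (Gamma_perm T h))) :
      (sgval h, Gamma_perm T h) \in Gamma T.
    by apply/imsetP; exists h; rewrite ?in_setT.
  by rewrite GSactC SactM mulgV Sact1.
have en : n = #|T| by rewrite -(bij_eq_card e_bij) card_ord.
subst n; have r_inj : injective (fun i => enum_rank (e i)).
  by move=> i j /enum_rank_inj/(bij_inj e_bij).
(* The witness moves [x] from the labelling [e] to the order of [enum T]; permutations of [T] then
   act on the inputs of [x] through conjugation by [r]. *)
pose r := perm r_inj; exists (Sact x r^-1) => g s /imsetP[h _ [-> ->]] {g s}.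
set s := Gamma_perm T h.
have [|t ft gx] := @renP _ (r * s * r^-1) _ _ (xfix h (r * s * r^-1) _).
  move=> i; rewrite !permM; apply: enum_rank_inj.
  have -> : enum_rank (e (r^-1 (s (r i)))) = r (r^-1 (s (r i))).
    by rewrite [RHS]permE.
  by rewrite permKV permE /Gamma_fun permE enum_rankK.
rewrite !GSactC gx !SactM; congr Sact; have -> : t = r * s * r^-1.
  by apply/permP => i; rewrite -ft.
by rewrite !mulgA mulgKV mulVg mul1g.
Qed.

End Renaming.

(** Combines the two equivariance axioms of an operad: [F] factors as permutations inside the blocks
    followed by a permutation of the blocks. *)
Lemma ren_ocomp (gT : finGroupType) (O : operad gT) k k' (n : 'I_k -> nat)
    (n' : 'I_k' -> nat) (f : 'I_k -> 'I_k')
    (g : forall i, 'I_(n i) -> 'I_(n' (f i))) F (x : O k) (x' : O k')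
    (y : forall i, O (n i)) (y' : forall i, O (n' i)) :
  ren f x x' -> (forall i, ren (g i) (y i) (y' (f i))) ->
  (forall i j, F (tagnat.Rank i j) = tagnat.Rank (f i) (g i j)) ->
  ren F (ocomp x y) (ocomp x' y').
Proof.
move=> [e [s [fs xx']]]; subst k; move: xx' => /= -> {x}.
have {fs} ef : f = s.
  by apply: functional_extensionality => i; rewrite fs cast_ord_id.
subst f => yy' FE.
have en : n = fun i => n' (s i).
  by apply: functional_extensionality => i; case: (yy' i).
subst n; have /fin_all_exists[t tP] i : exists t : 'S_(n' (s i)),
    g i =1 t /\ y i = Sact (y' (s i)) t.
  by have [t] := renP (yy' i); exists t.
have -> : y = fun i => Sact (y' (s i)) (t i).
  by apply: functional_extensionality_dep => i; case: (tP i).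
rewrite ocomp_sum_of_perms.
have -> : F = block_perm n' s \o cast_ord (sum_perm n' s) \o sum_of_perms t.
  apply: functional_extensionality => l; rewrite -[l]tagnat.sig2K /=.
  rewrite FE sum_of_permsE block_permE; congr tagnat.Rank.
  by case: (tP (tagnat.sig1 l)).
apply: (ren_comp (ren_perm (frefl _) erefl)).
exists (sum_perm n' s), (block_perm n' s); split=> //.
exact: ocomp_block_perm.
Qed.

Section AdmissibleOperad.
Variables (gT : finGroupType) (O : operad gT).

Section FixedFamily.
Variables (H : {group gT}) (T U : hset H) (p : T -> U).

(* It suffices to choose an operation over one point of each orbit of [U], and
   to transport it along the orbit. *)
Lemma fixed_family : fibrewise (admissible_sets O) p ->
  (forall h t, p (hact h t) = hact h (p t)) ->
  exists (n : U -> nat) (e : forall u, 'I_(n u) -> T) (y : forall u, O (n u)),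
    [/\ forall u, injective (e u),
        forall u t, p t = u <-> exists i, e u i = t
      & forall h u u' (f : 'I_(n u) -> 'I_(n u')), u' = hact h u ->
          (forall i, e u' (f i) = hact h (e u i)) ->
          ren f (Gact (sgval h) (y u)) (y u')].
Proof.
move=> fibO p_act.
(* Arity, labelling and operation over [v] are packed into one dependent pair, so that a single
   finite choice provides all three. *)
have /fin_all_exists[d dP] v : exists d : {n : nat & (('I_n -> T) * O n)%type},
    [/\ injective (tagged d).1,
        forall t, p t = v <-> exists i, (tagged d).1 i = t
      & forall h, hact h v = v -> forall f,
          (forall i, (tagged d).1 (f i) = hact h ((tagged d).1 i)) ->
          ren f (Gact (sgval h) (tagged d).2) (tagged d).2].
  have [K [sKH [B [j [memK j_inj j_act jP /admissibleP]]]]] := fibO v.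
  move=> [n [e [y [e_bij yfix]]]]; exists (existT _ n (j \o e, y)); split=> /=.
  - exact: inj_comp j_inj (bij_inj e_bij).
  - move=> t; split=> [/jP[b <-]|[i <-]]; last by apply/jP; exists (e i).
    by have [e' eK e'K] := e_bij; exists (e' b); rewrite e'K.
  - move=> h hv f fE; have hK : sgval h \in K by rewrite memK hv.
    have := yfix (subg K (sgval h)) f; rewrite subgK //; apply=> i.
    apply: j_inj; rewrite j_act fE; congr hact.
    by apply: val_inj; rewrite /= subgK.
(* The pick is constant on orbits, since the predicates agree there; the orbit contains [u], so the
   default is never returned. *)
pose r (u : U) := odflt u [pick v | [exists h : subg_of H, hact h u == v]].
have r_act h (u : U) : r (hact h u) = r u.
  rewrite /r (@eq_pick _ _ [pred v | [exists h : subg_of H, hact h u == v]]).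
    by case: pickP => // /(_ u) /existsP[]; exists 1; rewrite hact1.
  move=> v /=; apply/existsP/existsP => -[g gv].
    by exists (g * h); rewrite hactM.
  by exists (g * h^-1); rewrite hactM hactK.
have /fin_all_exists[a aP] u : exists a : subg_of H, hact a (r u) = u.
  rewrite /r; case: pickP => [v /existsP[h /eqP <-]|_] /=.
    by exists h^-1; rewrite hactK.
  by exists 1; rewrite hact1.
exists (fun u => tag (d (r u))).
exists (fun u i => hact (a u) ((tagged (d (r u))).1 i)).
exists (fun u => Gact (sgval (a u)) (tagged (d (r u))).2); split.
- by move=> u i i' /hact_inj; case: (dP (r u)) => inj _ _ /inj.
- move=> u t; have [_ dE _] := dP (r u); split=> [pt|[i <-]].
    have /dE[i ei] : p (hact (a u)^-1 t) = r u.
      by rewrite p_act pt -{2}(aP u) hactK.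
    by exists i; rewrite ei hactKV.
  by rewrite p_act (iffRL (dE _)) ?aP //; exists i.
- move=> h u u' f eu' /=; have er : r u' = r u by rewrite eu' r_act.
  move: f er (aP u'); move: (a u') (r u') => a' v f ev; subst v u'.
  move=> a'P fE.
  have [_ _ dfix] := dP (r u).
  (* This element fixes [r u]: it is the transport to [u], then [h], then the transport back from
     [hact h u]. *)
  have := dfix (a'^-1 * (h * a u)).
  rewrite !hactM aP -a'P hactK => /(_ erefl f) ren_f.
  have {ren_f} := ren_Gact (sgval a') (ren_f _).
  rewrite -!GactM /= mulKVg; apply=> i.
  by apply: (@hact_inj _ _ _ a'); rewrite fE !hactM hactKV.
Qed.

Lemma admissible_fibrewise : (forall h t, p (hact h t) = hact h (p t)) ->
  admissible O U -> fibrewise (admissible_sets O) p -> admissible O T.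
Proof.
move=> p_act /admissibleP[k [eU [x [eU_bij xfix]]]] fibO.
have [n [e [y [e_inj eP yfix]]]] := fixed_family fibO p_act.
apply/admissibleP; pose E (l : 'I_(\sum_i n (eU i))) := let q := tagnat.sig l in
  e (eU (tag q)) (tagged q).
have ER i (j : 'I_(n (eU i))) : E (tagnat.Rank i j) = e (eU i) j.
  by rewrite /E [tagnat.sig _]tagnat.rankK.
have pe u i : p (e u i) = u by apply/eP; exists i.
have [eU' eUK eU'K] := eU_bij.
have E_inj : injective E.
  move=> l l'; rewrite -[l]tagnat.sig2K -[l']tagnat.sig2K !ER.
  move: (tagnat.sig1 l) (tagnat.sig2 l) (tagnat.sig1 l') (tagnat.sig2 l').
  move=> i j i' j' ee; have /(can_inj eUK) ei : eU i = eU i'.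
    by rewrite -(pe _ j) ee pe.
  by subst i'; rewrite (e_inj _ _ _ ee).
have E_bij : bijective E.
  have /fin_all_exists[E' E'K] t : exists l, E l = t.
    have [i <-] : exists i, e (eU (eU' (p t))) i = t by apply/eP; rewrite eU'K.
    by exists (tagnat.Rank _ i).
  by exists E' => // l; apply: E_inj; rewrite E'K.
exists _, E, (ocomp x (fun i => y (eU i))); split=> // h F FE.
(* Acting by [h] sends block [i] to block [f i] and moves the inputs inside it by [g i], the shape
   required by [ren_ocomp]. *)
pose f i := eU' (hact h (eU i)).
have fE i : eU (f i) = hact h (eU i) by rewrite eU'K.
have /fin_all_exists[g gE] i : exists g : 'I_(n (eU i)) -> 'I_(n (eU (f i))),
    forall j, e (eU (f i)) (g j) = hact h (e (eU i) j).
  have /fin_all_exists[g gE] j :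
      exists j', e (eU (f i)) j' = hact h (e (eU i) j).
    by apply/eP; rewrite p_act pe fE.
  by exists g.
rewrite Gact_ocomp; apply: (ren_ocomp (f := f) (g := g)).
- exact: xfix.
- by move=> i; apply: yfix.
- by move=> i j; apply: E_inj; rewrite FE !ER gE.
Qed.

End FixedFamily.

(** * Closure properties of the admissible sets *)

Hypotheses (O0 : has_Gfixed O 0) (O2 : has_Gfixed O 2).

(** Substituting a fixed operation of arity n and the unit into the binary one raises the arity by
    one, starting from arity 0. *)
Lemma has_Gfixed_operad n : has_Gfixed O n.
Proof.
elim: n => // n IHn; have [b bfix] := O2.
pose m (i : 'I_2) := if i == ord0 then n else 1%N.
have /fin_all_exists[y yfix] i : exists y : O (m i), forall g, Gact g y = y.
  by rewrite /m; case: ifP => _ //; exists (ounit O); apply: Gact_ounit.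
have : has_Gfixed O (\sum_i m i).
  exists (ocomp b y) => g; rewrite Gact_ocomp bfix; congr ocomp.
  exact: functional_extensionality_dep.
by rewrite big_ord_recl big_ord1 addn1.
Qed.

Lemma admissible_trivial (H : {group gT}) (T : hset H) :
  (forall h (x : T), hact h x = x) -> admissible O T.
Proof.
move=> trivT; have [x xfix] := has_Gfixed_operad #|T|; apply/admissibleP.
exists #|T|, enum_val, x; split; first exact: enum_val_bij.
move=> h f fE; rewrite xfix; apply: ren_id => i.
by apply: enum_val_inj; rewrite fE trivT.
Qed.

Definition trivial_hset (H : {group gT}) (T : finType) : hset H :=
  @HSet gT H T (fun _ x => x) (fun _ => erefl) (fun _ _ _ => erefl).

Lemma admissible_iso (H : {group gT}) (T U : hset H) :
  hset_iso T U -> admissible O T -> admissible O U.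
Proof.
move=> [f f_bij f_act] /admissibleP[n [e [x [e_bij xfix]]]]; apply/admissibleP.
exists n, (f \o e), x; split; first exact: bij_comp.
move=> h s sE; apply: (xfix h) => i; apply: (bij_inj f_bij).
by rewrite f_act; apply: sE.
Qed.

Lemma admissible_res (K H : {group gT}) (sKH : K \subset H) (T : hset H) :
  admissible O T -> admissible O (res sKH T).
Proof.
move=> /admissibleP[n [e [x [e_bij xfix]]]]; apply/admissibleP.
by exists n, e, x; split=> // h; apply: (xfix (subg_incl sKH h)).
Qed.

(** Translating the operation by [a] suffices, since h a = a (h ^ a). *)
Lemma admissible_conj (H : {group gT}) (a : gT) (T : hset H) :
  admissible O T -> admissible O (conj_hset a T).
Proof.
move=> /admissibleP[n [e [x [e_bij xfix]]]]; apply/admissibleP.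
exists n, e, (Gact a x); split=> // h f fE.
rewrite -GactM conjgC GactM; apply: ren_Gact.
exact: (xfix (conj_sub h)).
Qed.

(** The fibres of the inclusion have at most one point, so the stabilisers act trivially on them. *)
Lemma admissible_sub (H : {group gT}) (T : hset H) (A : {set T})
    (actA : forall (h : subg_of H) x, x \in A -> hact h x \in A) :
  admissible O T -> admissible O (sub_hset actA).
Proof.
move=> OT; apply: (@admissible_fibrewise H (sub_hset actA) T val) => // u.
exists (stab u), (stab_sub u).
exists (trivial_hset (stab u) {t : sub_hset actA | val t == u}), val; split.
- exact: mem_stab.
- exact: val_inj.
- move=> k [t /= /eqP tu]; apply: val_inj => /=.
  by rewrite tu; apply/esym/stab_act.
- move=> t; split=> [/eqP tu|[[t' /= /eqP tu] <-]//].
  by exists (exist (fun t : sub_hset actA => val t == u) t tu).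
- exact: admissible_trivial.
Qed.

(** The coproduct maps to a trivial two-point set, with fibres [T] and [U] and stabiliser [H]. *)
Lemma admissible_sum (H : {group gT}) (T U : hset H) :
  admissible O T -> admissible O U -> admissible O (sum_hset T U).
Proof.
move=> OT OU; pose p (x : sum_hset T U) : trivial_hset H bool :=
  if x is inl _ then true else false.
have inclH (k : subg_of H) : subg_incl (subxx H) k = k by apply: val_inj.
apply: (@admissible_fibrewise H (sum_hset T U) (trivial_hset H bool) p).
- by move=> h [].
- exact: admissible_trivial.
- case; [exists H, (subxx H), T, inl | exists H, (subxx H), U, inr];
    split=> //= [h|t t' []//|k b|[t|t]].
  all: try by rewrite ?inclH ?eqxx ?(subgP h).
  all: try by split=> // _; exists t.
  all: by split=> // -[].
Qed.

(** The induced set maps to H/K by sending [h, t] to hK; the fibre over aK consists of the [a, t]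
    and is the conjugate of [T] by a, acted on by the stabiliser a K a^-1. *)
Lemma admissible_ind (K H : {group gT}) (sKH : K \subset H) (T : hset K) :
  admissible O T -> admissible O (coset_hset K H) ->
  admissible O (ind_hset sKH T).
Proof.
move=> OT OHK.
have elP q :
    ind_class sKH q \in [set ind_class sKH q | q in [set: subg_of H * T]].
  by apply/imsetP; exists q; rewrite ?in_setT.
pose el q : ind_hset sKH T := exist (fun B => B \in _) _ (elP q).
have el_act h q : hact h (el q) = el (h * q.1, q.2).
  exact/val_inj/ind_shift_class.
have elS y : exists q, y = el q.
  by case: y => B /= BP; have /imsetP[q _ e] := BP; exists q; apply: val_inj.
have lcos_eq (g h : gT) : (g *: K == h *: K) = (h^-1 * g \in K).
  rewrite -mem_lcoset; apply/eqP/idP => [<-|/lcoset_eqP->//].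
  exact: lcoset_refl.
have /fin_all_exists[p pE] (y : ind_hset sKH T) : exists C : coset_hset K H,
    forall q, y = el q -> val C = sgval q.1 *: K.
  have [[h t] ->] := elS y.
  have CP : sgval h *: K \in lcosets K H.
    by apply/lcosetsP; exists (sgval h); rewrite ?subgP.
  exists (exist (fun C => C \in _) _ CP) => q /(congr1 val)/ind_classP[k ->] /=.
  by apply/eqP; rewrite lcos_eq invMg invgK mulgKV subgP.
have pel q : val (p (el q)) = sgval q.1 *: K by apply: pE.
apply: (@admissible_fibrewise _ _ (coset_hset K H) p) => //.
  move=> h y; have [q ->] := elS y; apply: val_inj.
  by rewrite el_act pel /= pel lcosetM.
case=> C CP; have /lcosetsP[a aH eC] := CP; subst C.
pose h := subg H a; have ha : sgval h = a by rewrite subgK.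
have sKaH : (K :^ a^-1)%G \subset H by rewrite -(conjGid (groupVr aH)) conjSg.
exists (K :^ a^-1)%G, sKaH, (conj_hset a T), (fun t => el (h, t)); split.
- move=> g; rewrite -val_eqE /= -lcosetM lcos_eq mem_conjgV conjgE.
  by rewrite mulgA.
- move=> t t' /(congr1 val)/ind_classP[k []] /= /esym/eqP.
  rewrite -{2}[h]mulg1 (inj_eq (mulgI h)) eq_invg1 => /eqP k1 ->.
  have -> : k = 1 by apply: val_inj; apply: (congr1 sgval k1).
  by rewrite hact1.
- move=> k t; rewrite el_act; apply: val_inj; apply/esym/ind_classP.
  exists (conj_sub k); congr (_, _); apply: val_inj; rewrite /= ha conjgE.
  by rewrite invMg invgK mulgA mulgV mul1g.
- move=> y; have [[h' t] ->] := elS y.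
  split=> [/(congr1 val)|[b /(congr1 p) e]].
    rewrite pel /= => /eqP; rewrite lcos_eq => kK.
    exists (hact (subg K (a^-1 * sgval h')) t).
    apply: val_inj; apply/esym/ind_classP.
    exists (subg K (a^-1 * sgval h')); congr (_, _); apply: val_inj.
    by rewrite /= ha subgK // invMg invgK mulKVg.
  by rewrite -e; apply: val_inj; rewrite pel /= ha.
- exact: admissible_conj.
Qed.

Lemma admissible_indexing_system : indexing_system (admissible_sets O).
Proof.
split; [exact: admissible_trivial | exact: admissible_iso
  | exact: admissible_res | exact: admissible_conj | exact: admissible_sub
  | exact: admissible_sum | exact: admissible_ind].
Qed.

End AdmissibleOperad.

(** * Trees and linear operations *)

(** Both sides are [q] plus the sizes [m] of the blocks that precede (i, j) lexicographically. Hence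
    [sum_assoc] keeps positions, as [lin_compA] needs. *)
Lemma val_RankA k (n : 'I_k -> nat) (m : 'I_(\sum_i n i)%N -> nat)
    (i : 'I_k) (j : 'I_(n i)) (q : 'I_(m (tagnat.Rank i j))) :
  tagnat.Rank (tagnat.Rank i j) q =
  tagnat.Rank (p_ := fun i => (\sum_(j < n i) m (tagnat.Rank i j))%N) i
    (tagnat.Rank (p_ := fun j => m (tagnat.Rank i j)) j q) :> nat.
Proof.
have lt_Rank i1 (j1 : 'I_(n i1)) : (tagnat.Rank i1 j1 < tagnat.Rank i j)%N =
    (i1 < i)%N || (i1 == i) && (tagnat.Rank i1 j1 < tagnat.Rank i j)%N.
  have le_sig1 i2 (j2 : 'I_(n i2)) i3 (j3 : 'I_(n i3)) :
      (tagnat.Rank i2 j2 <= tagnat.Rank i3 j3)%N -> (i2 <= i3)%N.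
    move=> le; rewrite -(tagnat.Rank1K j2) -(tagnat.Rank1K j3).
    exact: (@tagnat.le_sig1 k n).
  case: (ltngtP i1 i) => [lti|gti|/val_inj e].
  - have [//|/le_sig1] := ltnP (tagnat.Rank i1 j1) (tagnat.Rank i j).
    by rewrite leqNgt lti.
  - rewrite (negbTE (_ : i1 != i)); last by rewrite -val_eqE neq_ltn gti orbT.
    have [/ltnW /le_sig1|//] := ltnP (tagnat.Rank i1 j1) (tagnat.Rank i j).
    by rewrite leqNgt gti.
  - by rewrite {}e in j1 *; rewrite eqxx.
have lt_Rank2 (j1 : 'I_(n i)) :
    (tagnat.Rank i j1 < tagnat.Rank i j)%N = (j1 < j)%N.
  by have := @tagnat.lt_Rank k n i j1 j; rewrite !ltEord.
rewrite [LHS]tagnat.RankEsum [RHS]tagnat.RankEsum [in RHS]tagnat.RankEsum addnA.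
congr (_ + _)%N.
rewrite big_mkcond sum_assoc (bigD1 i) //= addnC; congr (_ + _)%N; last first.
  by rewrite [RHS]big_mkcond; apply: eq_bigr => j1 _; rewrite -lt_Rank2.
rewrite [RHS]big_mkcond [RHS](bigD1 i) //= ltnn add0n; apply: eq_bigr => i1 ni1.
rewrite -big_mkcond; under eq_bigl => j1 do rewrite lt_Rank (negbTE ni1) orbF.
by case: ifP => _ //; rewrite big_pred0_eq.
Qed.

Section Trees.
Variables (gT : finGroupType) (S : symseq gT).

(** The predicate given to [epsilon] depends only on the orbit of [s], so by extensionality all
    members of an orbit get the same representative. *)
Lemma orbit_repr_proof n (s : S n) :
  exists p : S n * 'S_n, p.1 = epsilon (inhabits s)
    (fun r => exists t, s = Sact r t) /\ s = Sact p.1 p.2.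
Proof.
have ex : exists r t, s = Sact r t by exists s, 1; rewrite Sact1.
case: (epsilon_spec (inhabits s) _ ex) => t e.
by exists (epsilon (inhabits s) (fun r => exists t, s = Sact r t), t).
Qed.

Definition orbit_repr n (s : S n) : S n :=
  (proj1_sig (constructive_indefinite_description _ (orbit_repr_proof s))).1.

Definition repr_perm n (s : S n) : 'S_n :=
  (proj1_sig (constructive_indefinite_description _ (orbit_repr_proof s))).2.

Lemma orbit_reprK n (s : S n) : Sact (orbit_repr s) (repr_perm s) = s.
Proof.
rewrite /orbit_repr /repr_perm.
by case: constructive_indefinite_description => p /= [_ e].
Qed.

Lemma orbit_repr_Sact n (s : S n) t : orbit_repr (Sact s t) = orbit_repr s.
Proof.
rewrite /orbit_repr; do 2!case: constructive_indefinite_description => /=.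
move=> p [-> _] q [-> _]; rewrite (proof_irrelevance _ (inhabits (Sact s t))
  (inhabits s)); congr epsilon.
apply: functional_extensionality => r; apply: propositional_extensionality.
split=> -[u e]; last by exists (t * u); rewrite e SactM.
by exists (t^-1 * u); rewrite -SactM -e SactM mulVg Sact1.
Qed.

Lemma orbit_repr_idem n (s : S n) : orbit_repr (orbit_repr s) = orbit_repr s.
Proof. by rewrite -[in RHS](orbit_reprK s) orbit_repr_Sact. Qed.

Hypothesis Sfree : forall n, sigma_free S n.

Lemma Sact_inj n (s : S n) t u : Sact s t = Sact s u -> t = u.
Proof.
move=> e; apply/eqP; rewrite eq_sym eq_mulVg1; apply/eqP.
apply: (Sfree (x := s)).
by rewrite -SactM e SactM mulVg Sact1.
Qed.

Lemma repr_perm_Sact n (s : S n) t : repr_perm (Sact s t) = t * repr_perm s.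
Proof.
apply: (@Sact_inj _ (orbit_repr s)).
by rewrite -[in LHS](orbit_repr_Sact s t) orbit_reprK -SactM orbit_reprK.
Qed.

Lemma repr_perm_id n (s : S n) : orbit_repr s = s -> repr_perm s = 1.
Proof.
by move=> e; apply: (@Sact_inj _ (orbit_repr s)); rewrite orbit_reprK Sact1.
Qed.

Variables (V : eqType) (actV : gT -> V -> V).
Hypothesis actV1 : forall v, actV 1 v = v.
Hypothesis actVM : forall g h v, actV (g * h) v = actV g (actV h v).

(* Elements of the free S-algebra on V.  Modulo the relation
   (s . t)(w) = s(w \o t^-1) every operation symbol can be replaced by the
   chosen representative of its orbit, and by freeness in a single way, so no
   quotient is needed. *)
Inductive tree : Type :=
| Leaf of V
| Node n of {r : S n | orbit_repr r = r} & ('I_n -> tree).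

(** For s = r . p with r the representative, the branches are dictated by (r . p)(w) = r(w \o
    p^-1). *)
Definition node n (s : S n) (w : 'I_n -> tree) : tree :=
  Node (exist _ (orbit_repr s) (orbit_repr_idem s))
    (fun i => w ((repr_perm s)^-1 i)).

Lemma node_repr n (r : {r : S n | orbit_repr r = r}) w :
  Node r w = node (proj1_sig r) w.
Proof.
case: r => r e /=; rewrite /node; congr Node; last first.
  by apply: functional_extensionality => i; rewrite repr_perm_id // invg1 perm1.
move: (orbit_repr_idem r); rewrite e => e'.
by rewrite (proof_irrelevance _ e e').
Qed.

Lemma node_Sact n (s : S n) t w :
  node (Sact s t) w = node s (fun i => w (t^-1 i)).
Proof.
rewrite /node; congr Node; last first.
  apply: functional_extensionality => i.
  by rewrite repr_perm_Sact invMg permM.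
move: (orbit_repr_idem (Sact s t)); rewrite orbit_repr_Sact => e.
by rewrite (proof_irrelevance _ e (orbit_repr_idem s)).
Qed.

(** Recovers the relation (s' . t)(w' \o t) = s'(w') from an equality of normal forms; on a fixed
    tree it yields the permutations of the branches. *)
Lemma node_inj n (s s' : S n) w w' : node s w = node s' w' ->
  exists2 t, s = Sact s' t & forall i, w i = w' (t i).
Proof.
have nat_pair (P : nat -> Type) (x y : P n) :
    existT P n x = existT P n y -> x = y.
  exact: inj_pair2_eq_dec PeanoNat.Nat.eq_dec P n x y.
case=> /(nat_pair _ _ _) er /(nat_pair _ _ _) ew.
exists (repr_perm s * (repr_perm s')^-1).
  have e : Sact s' (repr_perm s')^-1 = orbit_repr s'.
    by rewrite -{1}(orbit_reprK s') SactM mulVg Sact1.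
  by rewrite -SactM e -er orbit_reprK.
move=> i; have /(congr1 (fun f => f (repr_perm s i))) := ew.
by rewrite permK permM.
Qed.

(** [Gact g] may send a chosen representative to another point of its orbit, so the result is
    normalised again through [node]. *)
Fixpoint tree_act (g : gT) (z : tree) : tree :=
  match z with
  | Leaf v => Leaf (actV g v)
  | Node _ r w => node (Gact g (proj1_sig r)) (fun i => tree_act g (w i))
  end.

Lemma tree_act_node g n (s : S n) w :
  tree_act g (node s w) = node (Gact g s) (fun i => tree_act g (w i)).
Proof.
by rewrite /= -(node_Sact _ _ (fun i => tree_act g (w i))) -GSactC orbit_reprK.
Qed.

Lemma tree_act1 z : tree_act 1 z = z.
Proof.
elim: z => [v|n r w IH] /=; first by rewrite actV1.
by rewrite node_repr Gact1; congr node; apply: functional_extensionality.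
Qed.

Lemma tree_actM g h z : tree_act (g * h) z = tree_act g (tree_act h z).
Proof.
elim: z => [v|n r w IH]; first by rewrite /= actVM.
rewrite node_repr !tree_act_node GactM; congr node.
exact: functional_extensionality.
Qed.

Fixpoint occ (v : V) (z : tree) : nat :=
  match z with
  | Leaf u => u == v
  | Node _ _ w => \sum_i occ v (w i)
  end.

Lemma occ_node v n (s : S n) w : occ v (node s w) = (\sum_i occ v (w i))%N.
Proof. by rewrite /= [RHS](reindex_inj (@perm_inj _ (repr_perm s)^-1)). Qed.

Lemma occ_act g v z : occ (actV g v) (tree_act g z) = occ v z.
Proof.
elim: z => [u|n r w IH]; last first.
  rewrite node_repr tree_act_node !occ_node.
  by apply: eq_bigr => i _; apply: IH.
rewrite /= (inj_eq (f := actV g)) //.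
by apply: (can_inj (g := actV g^-1)) => x; rewrite -actVM mulVg actV1.
Qed.

(* The endomorphism operad of [tree], cut down to the operations using each of
   their arguments exactly once. *)
Definition linear n (f : ('I_n -> tree) -> tree) : Prop :=
  forall w v, occ v (f w) = (\sum_i occ v (w i))%N.

Definition lin_sort n := {f : ('I_n -> tree) -> tree | linear f}.

Lemma lin_eq n (f f' : lin_sort n) :
  (forall w, proj1_sig f w = proj1_sig f' w) -> f = f'.
Proof.
case: f f' => f p [f' q] /= e.
have {}e : f = f' by apply: functional_extensionality.
by rewrite {}e in p *; rewrite (proof_irrelevance _ p q).
Qed.

Fact lin_Gact_proof n g (f : lin_sort n) :
  linear (fun w => tree_act g (proj1_sig f (fun i => tree_act g^-1 (w i)))).
Proof.
move=> w v; case: f => f fP /=.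
(* Counting v after acting by g is counting g^-1 v before; the same exchange in the arguments
   cancels the shift. *)
rewrite -{1}(actV1 v) -(mulgV g) actVM occ_act fP.
by apply: eq_bigr => i _; rewrite occ_act.
Qed.

Definition lin_Gact n g (f : lin_sort n) : lin_sort n :=
  exist _ _ (lin_Gact_proof g f).

Fact lin_Sact_proof n (f : lin_sort n) (s : 'S_n) :
  linear (fun w => proj1_sig f (fun i => w (s^-1 i))).
Proof.
move=> w v; rewrite (proj2_sig f).
by rewrite [RHS](reindex_inj (@perm_inj _ s^-1)).
Qed.

Definition lin_Sact n (f : lin_sort n) s : lin_sort n :=
  exist _ _ (lin_Sact_proof f s).

Fact lin_Gact1 n (f : lin_sort n) : lin_Gact 1 f = f.
Proof.
apply: lin_eq => w /=; rewrite tree_act1; congr (proj1_sig f).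
by apply: functional_extensionality => i; rewrite invg1 tree_act1.
Qed.

Fact lin_GactM n g h (f : lin_sort n) :
  lin_Gact (g * h) f = lin_Gact g (lin_Gact h f).
Proof.
apply: lin_eq => w /=; rewrite tree_actM; congr (tree_act g (tree_act h _)).
congr (proj1_sig f); apply: functional_extensionality => i.
by rewrite invMg tree_actM.
Qed.

Fact lin_Sact1 n (f : lin_sort n) : lin_Sact f 1 = f.
Proof.
apply: lin_eq => w /=; congr (proj1_sig f).
by apply: functional_extensionality => i; rewrite invg1 perm1.
Qed.

Fact lin_SactM n (f : lin_sort n) s t :
  lin_Sact (lin_Sact f s) t = lin_Sact f (t * s).
Proof.
apply: lin_eq => w /=; congr (proj1_sig f).
by apply: functional_extensionality => i; rewrite invMg permM.
Qed.

Fact lin_GSactC n g (f : lin_sort n) s :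
  lin_Gact g (lin_Sact f s) = lin_Sact (lin_Gact g f) s.
Proof. exact: lin_eq. Qed.

Definition lin_symseq : symseq gT :=
  SymSeq lin_Gact1 lin_GactM lin_Sact1 lin_SactM lin_GSactC.

Fact lin_unit_proof : linear (fun w : 'I_1 -> tree => w ord0).
Proof. by move=> w v; rewrite big_ord1. Qed.

Definition lin_unit : lin_sort 1 := exist _ _ lin_unit_proof.

Fact lin_comp_proof k (n : 'I_k -> nat) (f : lin_sort k)
    (h : forall i, lin_sort (n i)) :
  linear (fun w : 'I_(\sum_i n i)%N -> tree => proj1_sig f
    (fun i => proj1_sig (h i) (fun j => w (tagnat.Rank i j)))).
Proof.
move=> w v; rewrite (proj2_sig f) sum_assoc.
by apply: eq_bigr => i _; rewrite (proj2_sig (h i)).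
Qed.

Definition lin_comp k (n : 'I_k -> nat) (f : lin_sort k)
    (h : forall i, lin_sort (n i)) : lin_sort (\sum_i n i) :=
  exist _ _ (lin_comp_proof f h).

Lemma cast_linE m n (e : m = n) (f : lin_sort m) w :
  proj1_sig (cast e f) w = proj1_sig f (fun i => w (cast_ord e i)).
Proof.
case: _ / e w => w /=; congr (proj1_sig f).
by apply: functional_extensionality => i; rewrite cast_ord_id.
Qed.

Fact lin_Gact_unit (g : gT) : lin_Gact g lin_unit = lin_unit.
Proof. by apply: lin_eq => w /=; rewrite -tree_actM mulgV tree_act1. Qed.

Fact lin_Gact_comp k (n : 'I_k -> nat) g (f : lin_sort k)
    (h : forall i, lin_sort (n i)) :
  lin_Gact g (lin_comp f h) =
  lin_comp (lin_Gact g f) (fun i => lin_Gact g (h i)).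
Proof.
apply: lin_eq => w /=; congr (tree_act g (proj1_sig f _)).
by apply: functional_extensionality => i; rewrite -tree_actM mulVg tree_act1.
Qed.

Fact lin_comp1l n (f : lin_sort n) :
  cast (sum_unitl n) (lin_comp lin_unit (fun _ : 'I_1 => f)) = f.
Proof.
apply: lin_eq => w; rewrite cast_linE /=; congr (proj1_sig f).
apply: functional_extensionality => i; congr w; apply: val_inj.
by apply: etrans (tagnat.RankEsum i) _; rewrite big1 // => -[].
Qed.

Fact lin_comp1r n (f : lin_sort n) :
  cast (sum_unitr n) (lin_comp f (fun _ : 'I_n => lin_unit)) = f.
Proof.
apply: lin_eq => w; rewrite cast_linE /=; congr (proj1_sig f).
apply: functional_extensionality => i; congr w; apply: val_inj.
apply: etrans (tagnat.RankEsum (p_ := fun=> 1%N) (i := i) ord0) _.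
by rewrite addn0 -(big_ord_widen n (fun=> 1%N) (ltnW (ltn_ord i))) sum_unitr.
Qed.

Fact lin_compA k (n : 'I_k -> nat) (m : 'I_(\sum_i n i)%N -> nat)
    (f : lin_sort k) (h : forall i, lin_sort (n i))
    (l : forall l, lin_sort (m l)) :
  cast (sum_assoc m) (lin_comp (lin_comp f h) l) =
  lin_comp f (fun i => lin_comp (h i) (fun j => l (tagnat.Rank i j))).
Proof.
apply: lin_eq => w; rewrite cast_linE /=; congr (proj1_sig f).
apply: functional_extensionality => i; congr (proj1_sig (h i)).
apply: functional_extensionality => j; congr (proj1_sig (l _)).
apply: functional_extensionality => q; congr w; apply: val_inj.
exact: val_RankA.
Qed.

Fact lin_block_perm k (n : 'I_k -> nat) (s : 'S_k) (f : lin_sort k)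
    (h : forall i, lin_sort (n i)) :
  cast (sum_perm n s) (lin_comp (lin_Sact f s) (fun i => h (s i))) =
  lin_Sact (lin_comp f h) (block_perm n s).
Proof.
apply: lin_eq => w; rewrite cast_linE /=; congr (proj1_sig f).
apply: functional_extensionality => i; rewrite -[in RHS](permKV s i).
move: (s^-1 i) => {}i; congr (proj1_sig (h (s i))).
apply: functional_extensionality => j; congr w.
by apply: (@perm_inj _ (block_perm n s)); rewrite permKV block_permE.
Qed.

Fact lin_sum_of_perms k (n : 'I_k -> nat) (t : forall i, 'S_(n i))
    (f : lin_sort k) (h : forall i, lin_sort (n i)) :
  lin_comp f (fun i => lin_Sact (h i) (t i)) =
  lin_Sact (lin_comp f h) (sum_of_perms t).
Proof.
apply: lin_eq => w /=; congr (proj1_sig f).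
apply: functional_extensionality => i; congr (proj1_sig (h i)).
apply: functional_extensionality => j; congr w.
by apply: (@perm_inj _ (sum_of_perms t)); rewrite permKV sum_of_permsE permKV.
Qed.

Definition lin_operad : operad gT :=
  @Operad gT lin_symseq lin_unit lin_comp lin_Gact_unit lin_Gact_comp
    lin_comp1l lin_comp1r lin_compA lin_block_perm lin_sum_of_perms.

Fact node_linear n (s : S n) : linear (node s).
Proof. by move=> w v; rewrite occ_node. Qed.

Definition lin_gen n (s : S n) : lin_operad n := exist _ _ (node_linear s).

Fact lin_gen_Gact n (g : gT) (s : S n) :
  lin_gen (Gact g s) = Gact g (lin_gen s).
Proof.
apply: lin_eq => w; rewrite [RHS]tree_act_node; congr node.
by apply: functional_extensionality => i; rewrite -tree_actM mulgV tree_act1.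
Qed.

Fact lin_gen_Sact n (s : S n) (t : 'S_n) :
  lin_gen (Sact s t) = Sact (lin_gen s) t.
Proof. by apply: lin_eq => w; apply: node_Sact. Qed.

Definition lin_hom : symseq_hom S lin_operad :=
  @SymSeqHom gT S lin_operad lin_gen lin_gen_Gact lin_gen_Sact.

End Trees.

(** * Fixed trees *)

Section LinearTrees.
Variables (gT : finGroupType) (S : symseq gT).
Hypothesis Sfree : forall n, sigma_free S n.
Variables (V : eqType) (actV : gT -> V -> V).
Hypothesis actV1 : forall v, actV 1 v = v.
Hypothesis actVM : forall g h v, actV (g * h) v = actV g (actV h v).

(* If [z = s (w_0, ..., w_(n-1))] is fixed by [H], then by freeness [H] permutes
   the [w_i] through a unique action on ['I_n], for which [s] witnesses
   admissibility; [T] maps to this [H]-set, and the fibre over [i] is the set of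
   leaves of [w_i]. *)
Lemma leaves_indexing (I : subgroup_action_class gT) (isI : indexing_system I)
    (SI : class_incl (admissible_sets S) I) (z : tree S V) (H : {group gT})
    (T : hset H) (j : T -> V) :
  injective j -> (forall h t, j (hact h t) = actV (sgval h) (j t)) ->
  (forall h : subg_of H, tree_act actV (sgval h) z = z) ->
  (forall v, occ v z = [exists t, j t == v]) -> I H T.
Proof.
elim: z H T j => [v|n r w IH] H T j j_inj j_act z_fix z_occ.
  (* Only [v] occurs in a leaf, so all labels agree and [T] has at most one point. *)
  have jv t : j t = v.
    apply/esym/eqP; have /= := z_occ (j t).
    by case: eqP => // _; case: existsP => // -[]; exists t.
  by apply: is_trivial => // h x; apply: j_inj; rewrite !jv.
have {}z_fix (h : subg_of H) : exists s : 'S_n,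
    Gact (sgval h) (sval r) = Sact (sval r) s /\
    forall i, tree_act actV (sgval h) (w i) = w (s i).
  have := z_fix h; rewrite node_repr // tree_act_node // => /node_inj[] // s.
  by exists s.
have /fin_all_exists[sig sigP] := z_fix.
(* Freeness makes each [sig h] unique, which turns [sig] into an action; the factors in [sigM] are
   reversed because permutations multiply from left to right. *)
have sig1 : sig 1 = 1.
  by apply: (Sact_inj Sfree (s := sval r)); rewrite -(sigP 1).1 Gact1 Sact1.
have sigM g h : sig (g * h) = sig h * sig g.
  apply: (Sact_inj Sfree (s := sval r)).
  by rewrite -(sigP _).1 GactM (sigP h).1 GSactC (sigP g).1 SactM.
have act1 i : sig 1 i = i by rewrite sig1 perm1.
have actM g h i : sig (g * h) i = sig g (sig h i) by rewrite sigM permM.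
pose U : hset H := @HSet gT H 'I_n (fun h => sig h) act1 actM.
have IU : I H U.
  apply: SI; apply/admissibleP; exists n, id, (sval r).
  split; first by exists id.
  by move=> h f fE; apply: (ren_perm (s := sig h)) => //; apply: (sigP h).1.
have occ_hact (h : subg_of H) t i :
    occ (j (hact h t)) (w (sig h i)) = occ (j t) (w i).
  by rewrite j_act -(sigP h).2 occ_act.
have occ_sum t : (\sum_i occ (j t) (w i))%N = 1%N.
  by have /= -> := z_occ (j t); case: existsP => // -[]; exists t.
(* The label of [t] occurs once in the whole tree, hence in exactly one branch, [p t]. *)
have /fin_all_exists[p pE] t :
    exists i : U, forall i', occ (j t) (w i') = (i == i').
  have /eqP/sum_nat_eq1[i [_ oi other]] := occ_sum t.
  by exists i => i'; case: eqVneq => [<-//|ni]; apply: other; rewrite // eq_sym.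
have p_act h t : p (hact h t) = hact h (p t).
  apply/eqP; have := occ_hact h t (p t); rewrite !pE eqxx.
  by case: (p (hact h t) == _).
apply: (is_fibrewise isI p_act IU).
apply: (fibrewise_fibre (p_act := p_act)) => i.
apply: (IH i _ _ (fun x : fibre p_act i => j (val x))).
- by move=> x y /j_inj/val_inj.
- by move=> h x; rewrite [LHS]j_act.
- move=> h; have := (sigP (subg_incl (stab_sub i) h)).2 i.
  by rewrite (stab_act h : sig _ i = i).
- move=> v; case: existsP => [[x /eqP <-]|nx].
    by rewrite pE; have := valP x; rewrite inE => ->.
  (* Such a [v] either labels a point over another branch or occurs nowhere in the tree. *)
  have := z_occ v; case: existsP => [[t /eqP jt] _|_ /eqP].
    rewrite -jt pE; case: eqP => // pt; case: nx.
    have tP : t \in [set t | p t == i] by rewrite inE pt.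
    by exists (exist _ t tP); rewrite /= jt.
  by rewrite /= sum_nat_eq0 => /forallP/(_ i)/eqP.
Qed.

End LinearTrees.

(** * Embedding an H-set into a G-set, and evaluating free operations *)

Section Coinduction.
Variables (gT : finGroupType) (H : {group gT}) (T : hset H).

(** Right translation of the argument: the G-set coinduced from the trivial subgroup on [T] with a
    point added. *)
Definition coind_act (g : gT) (v : {ffun gT -> option T}) :
    {ffun gT -> option T} := [ffun x => v (x * g)].

Lemma coind_act1 v : coind_act 1 v = v.
Proof. by apply/ffunP => x; rewrite ffunE mulg1. Qed.

Lemma coind_actM g h v : coind_act (g * h) v = coind_act g (coind_act h v).
Proof. by apply/ffunP => x; rewrite !ffunE mulgA. Qed.

(** The orbit map of [t], extended by [None] off [H]; its value at 1 recovers [t]. *)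
Definition coind_emb (t : T) : {ffun gT -> option T} :=
  [ffun x => if x \in H then Some (hact (subg H x) t) else None].

Lemma coind_emb_inj : injective coind_emb.
Proof.
by move=> t u /ffunP/(_ 1); rewrite !ffunE group1 => -[/hact_inj].
Qed.

Lemma coind_emb_act h t :
  coind_emb (hact h t) = coind_act (sgval h) (coind_emb t).
Proof.
apply/ffunP => x; rewrite !ffunE groupMr ?subgP //; case: ifP => // xH.
by rewrite morphM ?subgP //= sgvalK hactM.
Qed.

End Coinduction.

Lemma admissible_free_generated (gT : finGroupType) (S : symseq gT)
    (F : operad gT) (eta : symseq_hom S F) (I : subgroup_action_class gT) :
  free_operad eta -> (forall n, sigma_free S n) -> indexing_system I ->
  class_incl (admissible_sets S) I -> class_incl (admissible_sets F) I.
Proof.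
move=> Ffree Sfree isI SI H T /admissibleP[n [e [x [e_bij xfix]]]].
have [f _ _] := Ffree _ (lin_hom Sfree (@coind_act1 _ _ T) (@coind_actM _ _ T)).
pose leaves (i : 'I_n) := @Leaf _ S _ (coind_emb (e i)).
apply: (leaves_indexing Sfree (@coind_act1 _ _ T) (@coind_actM _ _ T) isI SI
  (z := sval (f n x) leaves) (@coind_emb_inj _ _ T)).
- exact: coind_emb_act.
- move=> h; have [e' eK e'K] := e_bij.
  have [|s sE gx] := renP (xfix h (fun i => e' (hact h (e i))) _).
    by move=> i; rewrite e'K.
  (* At the translated leaves, the inverse in the conjugation action cancels on one side, and on the
     other [s] undoes the translation. *)
  have {gx} := congr1 (fun y => sval (f n y) (fun i =>
    tree_act (@coind_act _ _ T) (sgval h) (leaves i))) gx.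
  rewrite ss_hom_Gact ss_hom_Sact /=.
  have -> : (fun i => tree_act (@coind_act _ _ T) (sgval h)^-1
      (tree_act (@coind_act _ _ T) (sgval h) (leaves i))) = leaves.
    apply: functional_extensionality => i.
    by rewrite /= -coind_actM mulVg coind_act1.
  move=> ->; congr (sval (f n x)); apply: functional_extensionality => i.
  by rewrite /leaves /= -coind_emb_act -[in RHS](permKV s i) -sE e'K.
(* By linearity the occurrences can be counted in the tuple [leaves], where [e] lists each point of
   [T] once. *)
- move=> v; rewrite (svalP (f n x)) /=; case: existsP => [[t /eqP <-]|nv].
    have [e' eK e'K] := e_bij.
    rewrite (bigD1 (e' t)) //= e'K eqxx big1 // => i ni.
    rewrite (inj_eq (@coind_emb_inj _ _ T)) -(inj_eq (can_inj e'K)) eK.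
    by rewrite (negbTE ni).
  rewrite big1 // => i _; case: eqP => // ev.
  by case: nv; exists (e i); apply/eqP.
Qed.

Theorem theorem4p6 (gT : finGroupType) (S : symseq gT)
    (F : operad gT) (eta : symseq_hom S F) :
  free_operad eta -> N_symseq S ->
  class_eq (admissible_sets F) (generated_system (admissible_sets S)).
Proof.
move=> Ffree [Sfree [s0 s0_fix] [s2 s2_fix]] H T; split=> [FT I isI SI|].
  exact: (admissible_free_generated Ffree Sfree isI SI).
(* The admissible sets of [F] are themselves one of the systems intersected, because [eta] preserves
   fixed operations. *)
apply.
  apply: admissible_indexing_system.
    by exists (eta _ s0) => g; rewrite -ss_hom_Gact s0_fix.
  by exists (eta _ s2) => g; rewrite -ss_hom_Gact s2_fix.
move=> K U [x xfix]; exists (eta _ x) => g s gs.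
by rewrite -ss_hom_Sact -ss_hom_Gact xfix.
Qed.
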